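(* Let $\Delta=3$ and $n\geq 11$, and put $t=n+4-4\Delta=n-8$. Among all trees on $n$ vertices whose maximum degree $3$ is attained by exactly two vertices, the maximal energy tree has as many as possible $2$-branches, and the tree with maximal energy is $T_a(3,t)$.
   Context: For a simple graph $G$, the energy $E(G)$ is the sum of the absolute values of the eigenvalues of the adjacency matrix of $G$. A $2$-branch is a pendent vertex attached to a vertex of degree two. $P_k$ denotes the path on $k$ vertices. For $\Delta\geq 3$, $t\geq 3$: $T_a(\Delta,t)$ is the tree obtained from a path $P_t$ by attaching $\Delta-1$ pendent paths $P_2$ (each joined by an edge from one of its end vertices) to each of the two end vertices of $P_t$; $T_b(\Delta,t)$ is the tree obtained from a path $w_1w_2\cdots w_{t+2}$ by attaching $\Delta-1$ pendent paths $P_2$ to $w_1$ and $\Delta-2$ pendent paths $P_2$ to $w_{t+1}$. Both have $t+4\Delta-4$ vertices and exactly two vertices of degree $\Delta$. *)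

(* Defs.v *)
From HB Require Import structures.
From mathcomp Require Import all_boot all_order all_algebra.
From mathcomp Require Import complex.

Set Implicit Arguments.
Unset Strict Implicit.
Unset Printing Implicit Defensive.

Import Order.TTheory GRing.Theory Num.Theory.

Record sgraph := SGraph {
  vertex :> finType;
  adj : rel vertex;
  adj_sym : symmetric adj;
  adj_irr : irreflexive adj
}.

Definition isomorphic (G H : sgraph) : Prop :=
  exists f : G -> H, bijective f /\ forall x y, adj (f x) (f y) = adj x y.

Definition degree (G : sgraph) (v : G) : nat := #|[set u | adj v u]|.

Definition max_degree (G : sgraph) : nat := \max_(v : G) degree v.

Definition connected_graph (G : sgraph) : Prop :=
  0 < #|G| /\ forall x y : G, connect (@adj G) x y.

(* A closed walk x, y, x along a single edge is a [ucycle] of size 2, hence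
   the bound 3 on the length of a genuine cycle. *)
Definition acyclic_graph (G : sgraph) : Prop :=
  forall c : seq G, ucycle (@adj G) c -> size c < 3.

Definition is_tree (G : sgraph) : Prop := connected_graph G /\ acyclic_graph G.

Definition two_max_degree_tree (n D : nat) (G : sgraph) : Prop :=
  [/\ #|G| = n, is_tree G, max_degree G = D
    & #|[set v : G | degree v == max_degree G]| = 2].

Definition num_2branches (G : sgraph) : nat :=
  #|[set v : G | (degree v == 1)
                 && [exists u : G, adj v u && (degree u == 2)]]|.

Section Energy.
Local Open Scope ring_scope.
Variable R : rcfType.

Definition adjacency_mx (G : sgraph) : 'M[R[i]]_#|G| :=
  \matrix_(i, j) (adj (enum_val i) (enum_val j))%:R.

(* The complex roots of the characteristic polynomial, listed with algebraic
   multiplicity (unique up to permutation, see [eigenvaluesP]). *)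
Definition eigenvalues (G : sgraph) : seq R[i] :=
  sval (closed_field_poly_normal (char_poly (adjacency_mx G))).

Lemma eigenvaluesP (G : sgraph) :
  char_poly (adjacency_mx G) = \prod_(z <- eigenvalues G) ('X - z%:P).
Proof.
rewrite /eigenvalues; case: closed_field_poly_normal => s /= {1}->.
by rewrite (monicP (char_poly_monic _)) scale1r.
Qed.

Definition energy (G : sgraph) : R :=
  \sum_(z <- eigenvalues G) complex.Re `|z|.

End Energy.

Definition maximal_energy_tree (R : rcfType) (n D : nat) (G : sgraph) : Prop :=
  two_max_degree_tree n D G /\
  forall H : sgraph, two_max_degree_tree n D H -> (energy R H <= energy R G)%R.

(* Vertices of T_a(D, t): [inl i] is the i-th vertex of P_t; in
   [inr (s, k, far)], the boolean s selects the end of P_t ([false] the first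
   vertex, [true] the last one), k numbers the paths P_2 attached there, and
   far tells the pendent vertex of that P_2 from the one joined to P_t.
   [Ta_arc] lists every edge in one orientation.  Intended for t > 1. *)
Definition Ta_vertex (D t : nat) : finType :=
  ('I_t + bool * 'I_(D.-1) * bool)%type.

Definition Ta_arc (D t : nat) (x y : Ta_vertex D t) : bool :=
  match x, y with
  | inl i, inl j => j == i.+1 :> nat
  | inl i, inr (s, _, far) => ~~ far && (i == (if s then t.-1 else 0) :> nat)
  | inr (s, k, far), inr (s', k', far') =>
      [&& s == s', k == k', ~~ far & far']
  | inr _, inl _ => false
  end.

Definition Ta_adj (D t : nat) : rel (Ta_vertex D t) :=
  fun x y => Ta_arc x y || Ta_arc y x.

Lemma Ta_adj_sym (D t : nat) : symmetric (@Ta_adj D t).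
Proof. by move=> x y; rewrite /Ta_adj orbC. Qed.

Lemma Ta_adj_irr (D t : nat) : irreflexive (@Ta_adj D t).
Proof.
by case=> [i|[[s k] []]]; rewrite /Ta_adj orbb /= ?andbF //; apply: ltn_eqF.
Qed.

Definition T_a (D t : nat) : sgraph := SGraph (@Ta_adj_sym D t) (@Ta_adj_irr D t).

(* Main.v *)
(** If [a_1, ..., a_n] are the eigenvalues of [G] and
    [Q_G y = prod_j |y + i a_j|], then for two graphs of the same order
    [pi (E(G) - E(H)) / 2] is the integral of [ln (Q_G / Q_H)] over [y > 0]
    (Coulson); only monotonicity of an explicit primitive is needed, not the
    integral itself.  For a tree, [Q] obeys the deletion rule
    [Q_G = y Q_(G - v) + Q_(G - v - u)] at a leaf [v] with neighbour [u].  A tree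
    with exactly two vertices of degree 3 and no larger degree is determined by
    the distance [d] of the branch vertices and their legs [(a, b)] and
    [(c, e)], and [Q] is then explicit in Fibonacci polynomials.  Among the
    trees with [d >= 2], [Q] is pointwise maximal exactly for [T_a], where all
    legs have length 2.  Among those with [d = 1], [Q] is pointwise maximal for
    legs [(n - 8, 2)] and [(2, 2)].  For this rival [Q] exceeds that of [T_a]
    when [y > 1], but [T_a] gains more on [1/5 <= y <= 3/5] than it loses on
    [y >= 1]. *)
Require Import Defs.
From mathcomp Require Import boolp classical_sets functions topology normedtype.
From mathcomp Require Import derive realfun exp trigo.
From mathcomp Require Import all_boot all_order all_algebra.
From mathcomp Require Import reals.
From mathcomp Require Import all_fingroup complex.
From mathcomp Require Import zify ring lra.

Set Implicit Arguments.
Unset Strict Implicit.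
Unset Printing Implicit Defensive.

Import Order.TTheory GRing.Theory Num.Theory.

Local Open Scope ring_scope.

(** * Fibonacci polynomials and the polynomials of the trees *)

(** Ratios of polynomials are estimated only through [ln x <= x - 1], which bounds the derivative of
    the energy comparison below by a rational function. For branch vertices at distance at least 2,
    Vajda-type identities show that a leg of length 2 wins any exchange of vertices with the other
    leg at its branch vertex or with the middle path. The rival with adjacent branch vertices needs
    bounds valid for all [n] at once; they come from enclosing the quotient of consecutive Fibonacci
    polynomials between [y] and [y + y^-1]. The margin is thin: gains of [48^-1] over a length
    [3 / 10] and of [64^-1] over a length [1 / 10] add up to [128^-1], against a loss of at most
    [144^-1]. *)

Section Recurrence.
Variables (R : comPzRingType) (y : R).

Fixpoint linrec (u v : R) (k : nat) : R :=
  if k is k'.+1 then linrec v (y * v + u) k' else u.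

(* [fibp k.+1] is the polynomial [Q] of the path on [k] vertices. *)
Definition fibp : nat -> R := linrec 0 1.

Arguments linrec : simpl never.

Lemma linrecSS u v k :
  linrec u v k.+2 = y * linrec u v k.+1 + linrec u v k.
Proof. by elim: k u v => [|k IH] u v //; exact: IH. Qed.

Lemma fibpE : (fibp 0 = 0) * (fibp 1 = 1) * (fibp 2 = y) * (fibp 3 = y ^+ 2 + 1).
Proof. by rewrite /fibp /linrec; do !split; ring. Qed.

Lemma fibpSS k : fibp k.+2 = y * fibp k.+1 + fibp k.
Proof. exact: linrecSS. Qed.

(** Cutting an edge of the path: either the two pieces stay whole, or both ends of the edge are
    deleted. *)
Lemma linrecD u v i j :
  linrec u v (i + j).+1 = fibp i.+1 * linrec u v j.+1 + fibp i * linrec u v j.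
Proof.
elim: i j => [|i IH] j; first by rewrite !fibpE mul1r mul0r addr0.
by rewrite addSnnS IH fibpSS linrecSS; ring.
Qed.

Lemma fibpD i j : fibp (i + j).+1 = fibp i.+1 * fibp j.+1 + fibp i * fibp j.
Proof. exact: linrecD. Qed.

Lemma linrecE u v k : linrec u v k.+1 = u * fibp k + v * fibp k.+1.
Proof.
have := linrecD u v k 0; rewrite addn0 => ->.
by rewrite addrC mulrC [X in _ + X]mulrC.
Qed.

(* [w k.+2] stands for the polynomial of a rooted tree with a path of [k]
   vertices attached to its root, and [w 1] for that of the tree without its
   root; the value is the polynomial of the tree obtained by adding, at
   distance [d] from the root, a vertex with legs of lengths [a] and [b]. *)
Definition two_legs (w : nat -> R) (a b d : nat) : R :=
  fibp a.+1 * fibp b.+1 * w d + fibp (a + b).+2 * w d.+1.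

(* The branch vertices are at distance [d], with legs [a], [b] at one and
   [c], [e] at the other. *)
Definition tree_poly (a b d c e : nat) : R :=
  two_legs (linrec (fibp c * fibp e.+1 + fibp c.+1 * fibp e)
                   (fibp c.+1 * fibp e.+1)) a b d.

Lemma fibp_legs a b :
  fibp (a + b).+2
  = y * (fibp a.+1 * fibp b.+1) + (fibp a * fibp b.+1 + fibp a.+1 * fibp b).
Proof. by rewrite -addSn fibpD fibpSS; ring. Qed.

Lemma two_legsC w a b d : two_legs w a b d = two_legs w b a d.
Proof. by rewrite /two_legs addnC; ring. Qed.

Lemma tree_poly_swap a b d c e :
  (0 < d)%N -> tree_poly a b d c e = tree_poly c e d a b.
Proof.
by case: d => // d _; rewrite /tree_poly /two_legs !fibp_legs !linrecE !fibpSS; ring.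
Qed.

Lemma tree_poly1 a b c e :
  tree_poly a b 1 c e
  = fibp a.+1 * fibp b.+1 * (fibp c.+1 * fibp e.+1)
    + fibp (a + b).+2 * fibp (c + e).+2.
Proof. by rewrite /tree_poly /two_legs [fibp (c + e).+2]fibp_legs linrecSS /linrec; ring. Qed.

(** Obtained by cutting the edge between the leg [b] and the branch vertex. With [b] and [a + d]
    fixed the second summand is constant, so an exchange between the leg [a] and the middle path
    only changes the first. *)
Lemma two_legsE u v a b d : let w := linrec u v in
  two_legs w a b d = fibp b * fibp a.+1 * w d.+1 + fibp b.+1 * w (a + d).+2.
Proof.
move=> w; rewrite /two_legs fibp_legs -addnS {4}/w linrecD -/w.
by rewrite [w d.+2]linrecSS -/w; ring.
Qed.

(** A Vajda-type identity. Its right side is nonnegative for [y > 0], so index 3, a leg of length 2,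
    is the best way to split off part of a fixed total; [linrec_shift] says the same of a leg
    against the middle path. *)
Lemma fibp_shift i j :
  fibp 3 * fibp (i + j).+3 - fibp i.+3 * fibp j.+3 = fibp i * fibp j.
Proof.
have -> : (i + j).+3 = (i.+2 + j).+1 by lia.
by rewrite fibpE fibpD !fibpSS; ring.
Qed.

Lemma linrec_shift u v i j : let w := linrec u v in
  fibp 3 * w (i + j).+4 - fibp i.+4 * w j.+3 = fibp i.+1 * w j.
Proof.
move=> w; have -> : (i + j).+4 = (i.+3 + j).+1 by lia.
by rewrite /w fibpE linrecD !fibpSS !linrecSS; ring.
Qed.

End Recurrence.
Arguments linrec : simpl never.

(** * Pointwise comparison of the tree polynomials for [y > 0] *)

Section Comparison.
Variables (R : realFieldType) (y : R).
Hypothesis y_gt0 : 0 < y.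
Local Notation r := (fibp y).

Lemma linrec_gt0 u v k : 0 < u -> 0 < v -> 0 < linrec y u v k.
Proof.
elim: k u v => [//|k IH] u v u0 v0.
by apply: IH => //; rewrite addr_gt0 ?mulr_gt0.
Qed.

Lemma fibp_gt0 k : 0 < r k.+1.
Proof.
suff [] : 0 < r k.+1 /\ 0 <= r k by [].
elim: k => [|k [rk1 rk]]; first by rewrite !fibpE.
by rewrite fibpSS ltr_wpDr ?mulr_gt0 // ltW.
Qed.

Lemma fibp_ge0 k : 0 <= r k.
Proof. by case: k => [|k]; rewrite ?lexx ?ltW ?fibp_gt0. Qed.

(** With [a + b] fixed, [two_legs] depends on the two legs only through this product; the right side
    belongs to the legs [2] and [a + b - 2]. *)
Lemma fibp_prod_le a b : (0 < a)%N -> (0 < b)%N -> (2 < a + b)%N ->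
  r a.+1 * r b.+1 <= r 3 * r (a + b).-1.
Proof.
(* A leg of length 1 lies outside [fibp_shift]; there the gap is [r k]. *)
have one k : r 2 * r k.+3 <= r 3 * r k.+2.
  by rewrite -subr_ge0 [X in _ <= X](_ : _ = r k) ?fibp_ge0 // !fibpE !fibpSS; ring.
case: a b => [//|[|a]] [//|[|b]] _ _ ab; first by lia.
- exact: one.
- by rewrite addn1 [X in X <= _]mulrC; exact: one.
- have -> : (a.+2 + b.+2).-1 = (a + b).+3 by lia.
  by rewrite -subr_ge0 fibp_shift mulr_ge0 ?fibp_ge0.
Qed.

Lemma fibp_prod_lt a b : (0 < a)%N -> (0 < b)%N -> (3 < a + b)%N ->
  a != 2 -> b != 2 -> r a.+1 * r b.+1 < r 3 * r (a + b).-1.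
Proof.
have one k : r 2 * r k.+4 < r 3 * r k.+3.
  by rewrite -subr_gt0 [X in _ < X](_ : _ = r k.+1) ?fibp_gt0 // !fibpE !fibpSS; ring.
case: a b => [//|[|[|a]]] [//|[|[|b]]] _ _ ab //= _ _.
- by rewrite addn1 [X in X < _]mulrC; exact: one.
- have -> : (a.+2 + b.+3)%N = (a.+1 + b.+1).+3 by lia.
  by rewrite -subr_gt0 fibp_shift mulr_gt0 ?fibp_gt0.
Qed.

Section TwoLegs.
Variables u v : R.
Hypotheses (u_gt0 : 0 < u) (v_gt0 : 0 < v).
Local Notation w := (linrec y u v).
Local Notation F := (two_legs y w).

Let w_gt0 k : 0 < w k. Proof. exact: linrec_gt0. Qed.

Lemma two_legs_short b d : (0 < b)%N -> (1 < d)%N -> F 1 b d < F 2 b d.-1.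
Proof.
case: b d => [//|b] [|[//|d]] // _ _.
rewrite !two_legsE.
have -> : (2 + d.+2.-1 = 1 + d.+2)%N by lia.
rewrite ltrD2r /= -!mulrA ltr_pM2l ?fibp_gt0 //.
by rewrite -subr_gt0 [X in _ < X](_ : _ = w d) // !fibpE !linrecSS; ring.
Qed.

Lemma two_legs_long a d : (2 < a)%N -> (1 < d)%N -> F a 2 d < F 2 2 (a + d - 2).
Proof.
case: a d => [|[|[|a]]] // [|[|d]] // _ _.
rewrite !two_legsE.
have -> : (2 + (a.+3 + d.+2 - 2) = a.+3 + d.+2)%N by lia.
rewrite ltrD2r /= -!mulrA ltr_pM2l ?fibp_gt0 // -subr_gt0.
have -> : (a.+3 + d.+2 - 2).+1 = (a + d).+4 by lia.
by rewrite linrec_shift mulr_gt0 ?fibp_gt0.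
Qed.

(** [fibp_prod_le] makes one leg 2 at fixed [d]; then vertices move between the other leg and the
    middle path. For [a + b = 4] this second move is void and strictness comes from [fibp_prod_lt].
    The bound [5 < a + b + d] keeps the final distance at least 2. *)
Lemma two_legs_max a b d : (0 < a)%N -> (0 < b)%N -> (1 < d)%N ->
  (5 < a + b + d)%N -> (a != 2) || (b != 2) ->
  F a b d < F 2 2 (a + b + d - 4).
Proof.
move=> a0 b0 d1 abd ab.
have [ab3|ab2] := ltnP 2 (a + b); last first.
  have [-> ->] : a = 1 /\ b = 1 by lia.
  apply: lt_trans (two_legs_short _ _) _ => //; rewrite two_legsC.
  by have := @two_legs_short 2 d.-1; rewrite (_ : 1 + 1 + d - 4 = d.-2)%N; [apply; lia|lia].
have le1 : F a b d <= F (a + b - 2) 2 d.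
  rewrite /two_legs subnK; last by lia.
  rewrite lerD2r ler_pM2r // [r (a + b - 2).+1 * _]mulrC.
  by rewrite (_ : (a + b - 2).+1 = (a + b).-1)%N ?fibp_prod_le //; lia.
have [ab4|ab5|ab4] := ltngtP (a + b) 4.
- apply: le_lt_trans le1 _; rewrite (_ : a + b - 2 = 1)%N; last by lia.
  by rewrite (_ : a + b + d - 4 = d.-1)%N; [apply: two_legs_short|]; lia.
- apply: le_lt_trans le1 _.
  by rewrite (_ : a + b + d - 4 = a + b - 2 + d - 2)%N; [apply: two_legs_long|]; lia.
- rewrite (_ : a + b + d - 4 = d)%N; last by lia.
  rewrite /two_legs ab4 ltrD2r ltr_pM2r //.
  by have := @fibp_prod_lt a b; rewrite ab4; apply=> //; lia.
Qed.

End TwoLegs.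

Lemma tree_poly_right c e : (0 < c)%N -> (0 < e)%N ->
  exists u v, [/\ 0 < u, 0 < v & forall a b d,
    tree_poly y a b d c e = two_legs y (linrec y u v) a b d].
Proof.
case: c e => [//|c] [//|e] _ _; rewrite /tree_poly; do 2 eexists; split; last by [].
  by rewrite addr_gt0 // mulr_gt0 ?fibp_gt0.
by rewrite mulr_gt0 ?fibp_gt0.
Qed.

Lemma tree_poly_lt n a b d c e :
  (10 < n)%N -> (a + b + d + c + e).+1 = n ->
  [/\ 0 < a, 0 < b, 1 < d, 0 < c & 0 < e]%N ->
  ~~ [&& a == 2, b == 2, c == 2 & e == 2] ->
  tree_poly y a b d c e < tree_poly y 2 2 (n - 9) 2 2.
Proof.
have half a' b' d' c' e' : [/\ 0 < a', 0 < b', 1 < d', 0 < c' & 0 < e']%N ->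
    (5 < a' + b' + d')%N ->
    tree_poly y a' b' d' c' e' < tree_poly y 2 2 (a' + b' + d' - 4) c' e'
    \/ a' = 2 /\ b' = 2.
  case=> a0 b0 d1 c0 e0 abd.
  have [/andP[/eqP-> /eqP->]|ab] := boolP ((a' == 2) && (b' == 2)); first by right.
  left; have [u [v [u0 v0 E]]] := tree_poly_right c0 e0.
  by rewrite !E two_legs_max // -negb_and.
move=> n11 nE [a0 b0 d1 c0 e0].
(* The ends are optimised in turn, and the first must leave a distance of at least 2. If
   [a + b + d <= 5], the other end qualifies, as the five lengths add up to at least 10. *)
wlog abd : a b d c e nE a0 b0 d1 c0 e0 / (5 < a + b + d)%N => [hw|] ne.
  have [abd|abd] := ltnP 5 (a + b + d); first exact: hw.
  rewrite tree_poly_swap; last by lia.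
  by apply: hw => //; lia.
have H1 := half a b d c e (And5 a0 b0 d1 c0 e0) abd.
have H2 := half c e (a + b + d - 4)%N 2 2.
have {}H2 : tree_poly y 2 2 (a + b + d - 4) c e < tree_poly y 2 2 (n - 9) 2 2
   \/ (c = 2 /\ e = 2) /\ (a + b + d - 4 = n - 9)%N.
  rewrite tree_poly_swap; last by lia.
  have [||?|[? ?]] := H2; [by split; lia|by lia|left|by right; lia].
  rewrite (_ : n - 9 = c + e + (a + b + d - 4) - 4)%N //; lia.
case: H1 => [H1|[a2 b2]]; case: H2 => [H2|[[c2 e2] <-]].
- exact: lt_trans H1 H2.
- by rewrite c2 e2 in H1 *.
- by rewrite a2 b2 in H2 *; rewrite (_ : 2 + 2 + d - 4 = d)%N in H2 => //; lia.
- by rewrite a2 b2 c2 e2 in ne.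
Qed.

(** By [tree_poly1] the legs matter only through two products and the sums [a + b], [c + e].
    [fibp_prod_le] settles the products; the remaining gap is explicit with nonnegative
    coefficients. The totals [c + e = 2] and [c + e = 3] are separate because they have no room for
    two legs of length 2. *)
Lemma tree_poly_adjacent n a b c e :
  (10 < n)%N -> (a + b + c + e).+2 = n ->
  [/\ 0 < a, 0 < b, 0 < c & 0 < e]%N ->
  tree_poly y a b 1 c e <= tree_poly y (n - 8) 2 1 2 2.
Proof.
move=> n11 nE [a0 b0 c0 e0].
wlog lek : a b c e nE a0 b0 c0 e0 / (c + e <= a + b)%N => [hw|].
  have [/hw|/ltnW lek] := leqP (c + e) (a + b); first exact.
  by rewrite tree_poly_swap // hw //; lia.
rewrite !tree_poly1.
have le_ab : r a.+1 * r b.+1 <= r 3 * r (a + b).-1 by apply: fibp_prod_le => //; lia.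
have r0 k : 0 <= r k := fibp_ge0 k.
have y0 : 0 <= y := ltW y_gt0.
have sumE i : r (i + 2).+2 = r i.+4 by rewrite addn2.
have [ce2|ce3|ce3] := ltngtP (c + e) 3.
- have [-> ->] : c = 1 /\ e = 1 by lia.
  have [j [abE {}nE]] : exists j, (a + b = j.+4.+3 /\ n - 8 = j.+3)%N.
    by exists (a + b - 7)%N; lia.
  rewrite abE nE sumE /= in le_ab *.
  have {}le_ab : r a.+1 * r b.+1 * (r 2 * r 2) <= r 3 * r j.+4.+2 * (r 2 * r 2).
    by rewrite ler_wpM2r ?mulr_ge0.
  apply: (le_trans (lerD le_ab (lexx _))); rewrite -subr_ge0.
  rewrite [X in _ <= X](_ : _ = y * r j.+3 + (y ^+ 2 + 1) * (y * r j.+3 + (1 + y ^+ 2) * r j.+2)).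
    by rewrite !(addr_ge0, mulr_ge0, exprn_ge0).
  by rewrite !fibpSS !fibpE; ring.
- have hij : exists i j, [/\ (a + b = i.+4)%N, (c + e = j.+4)%N & (n - 8 = (i + j).+2)%N].
    by exists (a + b - 4)%N, (c + e - 4)%N; split; lia.
  have le_ce : r c.+1 * r e.+1 <= r 3 * r (c + e).-1 by apply: fibp_prod_le => //; lia.
  have [i [j [abE ceE ->]]] := hij.
  rewrite abE ceE sumE /= in le_ab le_ce *.
  have le4 : r a.+1 * r b.+1 * (r c.+1 * r e.+1) <= r 3 * r i.+3 * (r 3 * r j.+3).
    by rewrite ler_pM ?mulr_ge0.
  apply: (le_trans (lerD le4 (lexx _))); rewrite -subr_ge0.
  rewrite [X in _ <= X](_ : _ = (y ^+ 4 + 2 * y ^+ 2) * (r i * r j)).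
    by rewrite !(addr_ge0, mulr_ge0, exprn_ge0).
  have -> : (i + j).+4.+2 = (i + j.+4.+1).+1 by lia.
  have -> : (i + j).+3 = (i + j.+2).+1 by lia.
  by rewrite !fibpD !fibpSS !fibpE; ring.
- have [j [abE {}nE]] : exists j, (a + b = j.+4.+2 /\ n - 8 = j.+3)%N.
    by exists (a + b - 6)%N; lia.
  have -> : r c.+1 * r e.+1 = r 2 * r 3.
    have [[-> ->]|[-> ->]] : (c = 1 /\ e = 2)%N \/ (c = 2 /\ e = 1)%N by lia.
      by [].
    exact: mulrC.
  rewrite abE nE ce3 sumE /= in le_ab *.
  have {}le_ab : r a.+1 * r b.+1 * (r 2 * r 3) <= r 3 * r j.+4.+1 * (r 2 * r 3).
    by rewrite ler_wpM2r ?mulr_ge0.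
  apply: (le_trans (lerD le_ab (lexx _))); rewrite -subr_ge0.
  rewrite [X in _ <= X](_ : _ = (y ^+ 4 + 2 * y ^+ 2) * r j.+2).
    by rewrite !(addr_ge0, mulr_ge0, exprn_ge0).
  by rewrite !fibpSS !fibpE; ring.
Qed.

(* Here [k = n - 11]; by [tree_poly_adjacent] only the rival [Tb] is not
   dominated pointwise. *)
Section NearestRival.
Variable k : nat.
Let Ta := tree_poly y 2 2 k.+2 2 2.
Let Tb := tree_poly y k.+3 2 1 2 2.

Lemma rival_subE : Ta - Tb = y * (y ^+ 2 + 1) * (1 - y ^+ 2) * r k.+1.
Proof.
rewrite /Ta /Tb tree_poly1 addn2 /tree_poly /two_legs !linrecE.
by rewrite !fibpSS !fibpE; ring.
Qed.

Let TaE : Ta = (y ^+ 2 + 1) *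
   (r k.+2 * ((y ^+ 2 + 1) * (y ^+ 6 + 7 * y ^+ 4 + 11 * y ^+ 2 + 1))
    + r k.+1 * (y * (y ^+ 6 + 7 * y ^+ 4 + 11 * y ^+ 2 + 5))).
Proof.
rewrite /Ta /tree_poly /two_legs !linrecE.
by rewrite !fibpSS !fibpE; ring.
Qed.

(** Together with [r_upper], this encloses [r k.+2 / r k.+1] independently of [k]. As [TaE] is
    linear in the two values, the estimates below become polynomial inequalities in [y] alone. *)
Let r_lower : y * r k.+1 <= r k.+2.
Proof. by rewrite fibpSS lerDl fibp_ge0. Qed.

Let r_upper : r k.+2 * y <= (y ^+ 2 + 1) * r k.+1.
Proof.
suff : y * r k <= r k.+1 by rewrite fibpSS; nra.
by case: k => [|j]; rewrite ?[in X in _ <= X]fibpSS ?lerDl ?fibp_ge0 // !fibpE mulr0 ler01.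
Qed.

Let y_ge0 : 0 <= y := ltW y_gt0.

Let y2_gt0 : 0 < y ^+ 2 + 1.
Proof. by rewrite ltr_wpDl ?exprn_ge0. Qed.

Let P_gt0 : 0 < y ^+ 6 + 7 * y ^+ 4 + 11 * y ^+ 2 + 1.
Proof. by rewrite ltr_wpDl // !addr_ge0 ?mulr_ge0 ?exprn_ge0. Qed.

Let Ta_gt0 : 0 < Ta.
Proof.
have P'_gt0 : 0 < y ^+ 6 + 7 * y ^+ 4 + 11 * y ^+ 2 + 5.
  by rewrite ltr_wpDl // !addr_ge0 ?mulr_ge0 ?exprn_ge0.
by rewrite TaE mulr_gt0 // addr_gt0 // !mulr_gt0 ?fibp_gt0.
Qed.

Let relE : 1 - Tb / Ta = (Ta - Tb) / Ta.
Proof. by field; rewrite gt_eqF. Qed.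

(** [r_lower] reduces the claim to a polynomial of degree 8 dominating [36 * y ^+ 5]. The bound is
    [(y ^+ 2 - 1) / (36 * y ^+ 5)] in disguise: it keeps the factor that changes sign and has an
    elementary primitive vanishing at infinity. *)
Lemma rival_tail : 1 <= y -> - ((y ^- 3 - y ^- 5) / 36) <= 1 - Tb / Ta.
Proof.
move=> y1; rewrite relE.
have -> : - ((y ^- 3 - y ^- 5) / 36) = - (y ^+ 2 - 1) / (36 * y ^+ 5).
  by field; rewrite gt_eqF.
have y5 : 0 < 36 * y ^+ 5 by rewrite mulr_gt0 ?exprn_gt0.
rewrite ler_pdivlMr // mulrAC ler_pdivrMr // rival_subE.
have TaL : (y ^+ 2 + 1) * r k.+1 * y * (36 * y ^+ 5) <= Ta.
  apply: (@le_trans _ _ ((y ^+ 2 + 1) * r k.+1 * y *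
      (y ^+ 8 + 9 * y ^+ 6 + 25 * y ^+ 4 + 23 * y ^+ 2 + 6))); last first.
    rewrite TaE -!mulrA ler_pM2l // -subr_ge0.
    rewrite [X in _ <= X](_ : _ = (r k.+2 - y * r k.+1) *
      ((y ^+ 2 + 1) * (y ^+ 6 + 7 * y ^+ 4 + 11 * y ^+ 2 + 1))); last by ring.
    by rewrite !mulr_ge0 ?subr_ge0 // ltW.
  rewrite ler_pM2l ?mulr_gt0 ?fibp_gt0 // -subr_ge0.
  rewrite [X in _ <= X](_ : _ = y ^+ 4 * (25 - 36 * y + 13 * y ^+ 2)
    + (y ^+ 2 * (y ^+ 6 - 4 * y ^+ 4 + 23) + 6)); last by ring.
  (* The discriminant [36 ^ 2 - 4 * 13 * 25 = -4] is barely negative; with 37 in place of 36 it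
     would be positive. *)
  have q1 : 0 <= 25 - 36 * y + 13 * y ^+ 2.
    by have := sqr_ge0 (13 * y - 18); nra.
  have q2 : 0 <= y ^+ 6 - 4 * y ^+ 4 + 23.
    have -> : y ^+ 6 = (y ^+ 2) ^+ 3 by rewrite -exprM.
    have -> : y ^+ 4 = (y ^+ 2) ^+ 2 by rewrite -exprM.
    have : 0 <= y ^+ 2 by rewrite exprn_ge0.
    by move: (y ^+ 2) => w w0; have := sqr_ge0 (3 * w - 8); nra.
  by rewrite !addr_ge0 ?mulr_ge0 ?exprn_ge0.
have : 0 <= y ^+ 2 - 1 by rewrite subr_ge0 expr_ge1.
by nra.
Qed.

(** [r_upper] bounds [Ta * y] by [(y ^+ 2 + 1) * r k.+1] times the polynomial of degree 10 in the
    hypothesis; the same factor occurs in [(Ta - Tb) * y]. *)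
Lemma rival_head (c : R) : 0 <= c -> y <= 1 ->
  c * (y ^+ 10 + 10 * y ^+ 8 + 33 * y ^+ 6 + 41 * y ^+ 4 + 18 * y ^+ 2 + 1)
     <= y ^+ 2 * (1 - y ^+ 2) -> c <= 1 - Tb / Ta.
Proof.
move=> c0 y1 hc; rewrite relE ler_pdivlMr // -(ler_pM2r y_gt0) rival_subE.
have TaU : Ta * y <= (y ^+ 2 + 1) * r k.+1 *
   (y ^+ 10 + 10 * y ^+ 8 + 33 * y ^+ 6 + 41 * y ^+ 4 + 18 * y ^+ 2 + 1).
  rewrite TaE -!mulrA ler_pM2l // -subr_ge0.
  rewrite [X in _ <= X](_ : _ = ((y ^+ 2 + 1) * r k.+1 - r k.+2 * y) *
      ((y ^+ 2 + 1) * (y ^+ 6 + 7 * y ^+ 4 + 11 * y ^+ 2 + 1))); last by ring.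
  by rewrite !mulr_ge0 ?subr_ge0 // ltW.
rewrite -[c * Ta * y]mulrA; apply: le_trans (ler_wpM2l c0 TaU) _.
have : 0 <= (y ^+ 2 + 1) * r k.+1 by rewrite mulr_ge0 ?fibp_ge0 // ltW.
move=> r'; have := ler_wpM2l r' hc; rewrite mulrCA => /le_trans; apply.
by rewrite [X in X <= _](_ : _ = y * (y ^+ 2 + 1) * (1 - y ^+ 2) * r k.+1 * y) //; ring.
Qed.

Lemma rival_unit : y <= 1 -> 0 <= 1 - Tb / Ta.
Proof.
move=> y1; apply: rival_head => //; rewrite mul0r mulr_ge0 ?exprn_ge0 //.
by rewrite subr_ge0 exprn_ile1.
Qed.

(** The constant is rounded down from what [rival_head] allows at the ends of the interval, about
    [1 / 46.6] at [5^-1] and [1 / 46] at [2^-1]. In [rival_middle] the value at [3 / 5] is about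
    [1 / 63]. *)
Lemma rival_inner : 5^-1 <= y <= 2^-1 -> 48^-1 <= 1 - Tb / Ta.
Proof.
move=> /andP[y1 y2]; apply: rival_head; [by lra|by lra|].
have : 25^-1 <= y ^+ 2 <= 4^-1 by apply/andP; split; nra.
have E m : y ^+ (2 * m) = (y ^+ 2) ^+ m by rewrite exprM.
rewrite (E 5) (E 4) (E 3) (E 2).
move: (y ^+ 2) => w /andP[w1 w2].
have w30 : 0 <= w ^+ 3 <= 4^-1 * w ^+ 2 by apply/andP; split; nra.
have w40 : 0 <= w ^+ 4 <= 4^-1 * w ^+ 3 by apply/andP; split; nra.
have w50 : 0 <= w ^+ 5 <= 4^-1 * w ^+ 4 by apply/andP; split; nra.
nra.
Qed.

Lemma rival_middle : 2^-1 <= y <= 3 / 5 -> 64^-1 <= 1 - Tb / Ta.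
Proof.
move=> /andP[y1 y2]; apply: rival_head; [by lra|by lra|].
have : 4^-1 <= y ^+ 2 <= 9 / 25 by apply/andP; split; nra.
have E m : y ^+ (2 * m) = (y ^+ 2) ^+ m by rewrite exprM.
rewrite (E 5) (E 4) (E 3) (E 2).
move: (y ^+ 2) => w /andP[w1 w2].
have w30 : 0 <= w ^+ 3 <= 9 / 25 * w ^+ 2 by apply/andP; split; nra.
have w40 : 0 <= w ^+ 4 <= 9 / 25 * w ^+ 3 by apply/andP; split; nra.
have w50 : 0 <= w ^+ 5 <= 9 / 25 * w ^+ 4 by apply/andP; split; nra.
nra.
Qed.

End NearestRival.

End Comparison.

(** * Comparing energies without integrals *)

Section Coulson.
Import numFieldNormedType.Exports.
Local Open Scope classical_set_scope.
Local Notation pi := trigo.pi.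
Variable R : realType.

Lemma mean_value (f df : R -> R) (a b : R) : a < b ->
  (forall x, a <= x <= b -> is_derive x 1 f (df x)) ->
  exists2 c, a <= c <= b & f b - f a = df c * (b - a).
Proof.
move=> ab H; have [||c] := @MVT R f df a b ab.
- move=> x; rewrite in_itv /= => /andP[/ltW ax /ltW xb].
  by apply: H; rewrite ax.
- apply: derivable_within_continuous => x; rewrite in_itv /= => xab.
  by have D := H x xab; exact: ex_derive.
- by rewrite in_itv /= => /andP[/ltW ac /ltW cb] ->; exists c; rewrite ?ac.
Qed.

(** Stands in for monotonicity of the integral, by the mean value theorem. *)
Lemma le_growth (f df : R -> R) (c a b : R) : a <= b ->
  (forall x, a <= x <= b -> is_derive x 1 f (df x)) ->
  (forall x, a <= x <= b -> c <= df x) ->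
  c * (b - a) <= f b - f a.
Proof.
rewrite le_eqVlt => /predU1P[->|ab] D H; first by rewrite !subrr mulr0.
have [x xab ->] := mean_value ab D.
by rewrite ler_wpM2r ?H // subr_ge0 ltW.
Qed.

Lemma lt_growth (f df : R -> R) (a b : R) : a < b ->
  (forall x, a <= x <= b -> is_derive x 1 f (df x)) ->
  (forall x, a <= x <= b -> 0 < df x) -> f a < f b.
Proof.
move=> ab D H; have [x xab E] := mean_value ab D.
by rewrite -subr_gt0 E mulr_gt0 ?H // subr_gt0.
Qed.

(* A primitive in [y] of [ln (1 + x ^+ 2 / y ^+ 2) / 2], growing from [0] at
   [0] to [pi / 2 * `|x|] at infinity. *)
Definition coulson (x y : R) : R :=
  y * (ln (1 + (x / y) ^+ 2) / 2) + `|x| * atan (y / `|x|).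

Lemma coulson0 y : coulson 0 y = 0.
Proof.
by rewrite /coulson mul0r expr0n addr0 ln1 normr0 !mul0r mulr0 addr0.
Qed.

Let ln_arg_gt0 (x y : R) : 0 < 1 + (x / y) ^+ 2.
Proof. by rewrite ltr_pwDl // sqr_ge0. Qed.

Lemma is_derive_coulson (x y : R) : 0 < y ->
  is_derive y 1 (coulson x) (ln (1 + (x / y) ^+ 2) / 2).
Proof.
move=> y0; have [->|x0] := eqVneq x 0.
  rewrite mul0r expr0n addr0 ln1 mul0r.
  rewrite (_ : coulson 0 = cst 0); first exact: is_derive_cst.
  by apply/funext => z; rewrite coulson0.
have yn0 : y != 0 by rewrite gt_eqF.
have nx0 : `|x| != 0 by rewrite normr_eq0.
have Di := @is_deriveV R id y 1 1 yn0 (is_derive_id y 1).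
have Dq := is_deriveD (is_derive_cst (1 : R) y 1)
                      (is_deriveX 2 (is_deriveM (is_derive_cst x y 1) Di)).
have Dl := @is_derive1_comp R (@ln R) _ y _ _ (is_derive1_ln (ln_arg_gt0 x y)) Dq.
have Dm := is_deriveM (is_derive_id y 1) (is_derive_cst (`|x|^-1) y 1).
have Da := @is_derive1_comp R (@atan R) _ y _ _ (is_derive1_atan _) Dm.
have := is_deriveD
  (is_deriveM (is_derive_id y 1) (is_deriveM Dl (is_derive_cst (2^-1 : R) y 1)))
  (is_deriveM (is_derive_cst `|x| y 1) Da).
move/is_derive_eq; apply.
set L := ln (1 + (x / y) ^+ 2); pose A := atan (y / `|x|).
transitivity (y * (L * 0 + 2^-1 * ((1 + (x / y) ^+ 2)^-1 *
    (0 + 2 * (x / y) * (x * (- y ^- 2 * 1) + y^-1 * 0)))) + L / 2 * 1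
  + (`|x| * ((1 + (y / `|x|) ^+ 2)^-1 * (y * 0 + `|x|^-1 * 1)) + A * 0)).
  by [].
have -> : (y / `|x|) ^+ 2 = (y / x) ^+ 2 by rewrite !expr_div_n real_normK ?num_real.
have xy0 : x ^+ 2 + y ^+ 2 != 0 by rewrite gt_eqF // ltr_wpDl ?exprn_gt0 ?sqr_ge0.
by field; rewrite nx0 x0 xy0 yn0.
Qed.

Lemma coulson_ge0 (x y : R) : 0 < y -> 0 <= coulson x y.
Proof.
move=> y0; have at0 : 0 <= atan (y / `|x|).
  by rewrite -(@atan0 R) le_atan // divr_ge0 // ltW.
rewrite addr_ge0 //; last by rewrite mulr_ge0.
by rewrite !mulr_ge0 ?ln_ge0 ?lerDl ?sqr_ge0 ?invr_ge0 // ltW.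
Qed.

Lemma atan_le (z : R) : 0 <= z -> atan z <= z.
Proof.
rewrite le_eqVlt => /predU1P[<-|z0]; first by rewrite atan0.
have [c _] := @mean_value _ (fun c => (1 + c ^+ 2)^-1) 0 z z0 (fun c _ => is_derive1_atan c).
rewrite atan0 !subr0 => ->; rewrite ler_piMl ?(ltW z0) // invf_le1 ?lerDl ?sqr_ge0 //.
by rewrite ltr_pwDl ?sqr_ge0.
Qed.

(** Near 0 the logarithmic term is of order [y * ln y^-1]; putting [y = t ^+ 2] gives a bound linear
    in [t]. *)
Lemma coulson_near0 (x t : R) : 0 < t -> t <= 1 ->
  coulson x (t ^+ 2) <= 3 * t * (1 + `|x|).
Proof.
move=> t0 t1; have x0 := normr_ge0 x.
have tn0 : t != 0 by rewrite gt_eqF.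
(* Chosen so that [(1 + s) ^+ 4] dominates the argument of the logarithm, which is then at most
   [4 * s]. *)
pose s := (1 + `|x|) / t.
have s0 : 0 < s by rewrite divr_gt0 ?ltr_pwDl.
have le_ln : ln (1 + (x / t ^+ 2) ^+ 2) <= 4 * s.
  have le4 : 1 + (x / t ^+ 2) ^+ 2 <= (1 + s) ^+ 4.
    have : (x / t ^+ 2) ^+ 2 <= s ^+ 4.
      rewrite -real_normK ?num_real // -[4%N]/(2 * 2)%N exprM lerXn2r ?nnegrE ?sqr_ge0 //.
      rewrite normrM normfV (ger0_norm (sqr_ge0 t)) /s expr_div_n.
      by rewrite ler_pM2r ?invr_gt0 ?exprn_gt0 //; nra.
    have : 0 <= s ^+ 2 by apply: sqr_ge0.
    have : 0 <= s ^+ 3 by apply: exprn_ge0; exact: ltW.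
    by nra.
  have s1 : 0 < 1 + s by rewrite addr_gt0.
  apply: (@le_trans _ _ (ln ((1 + s) ^+ 4))).
    by rewrite ler_ln ?posrE ?exprn_gt0.
  rewrite lnXn // -[X in X <= _]mulr_natl ler_pM2l // le_ln1Dx //.
  by rewrite (lt_trans _ s0) // ltrN10.
have -> : 3 * t * (1 + `|x|) = t ^+ 2 * (4 * s / 2) + t * (1 + `|x|).
  by rewrite /s; field.
rewrite lerD //.
  by rewrite ler_wpM2l ?sqr_ge0 // ler_pM2r ?invr_gt0.
have [->|nx0] := eqVneq x 0; first by rewrite normr0 mul0r addr0 mulr1 ltW.
have := atan_le (divr_ge0 (sqr_ge0 t) x0); move/(ler_wpM2l x0)/le_trans; apply.
by rewrite mulrC divfK ?normr_eq0 //; nra.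
Qed.

Lemma cvgy_coulson (x : R) : coulson x y @[y --> +oo] --> pi / 2 * `|x|.
Proof.
rewrite -[X in _ --> X]add0r; apply: cvgD.
  apply: (@squeeze_cvgr _ _ _ _ (cst 0) (fun y => x ^+ 2 / 2 / y)).
  - near=> y; have y0 : 0 < y by near: y; apply: nbhs_pinfty_gt; rewrite num_real.
    rewrite mulr_ge0 ?divr_ge0 ?ln_ge0 ?lerDl ?sqr_ge0 ?(ltW y0) //=.
    have : ln (1 + (x / y) ^+ 2) <= (x / y) ^+ 2.
      by rewrite le_ln1Dx // (lt_le_trans _ (sqr_ge0 _)) // ltrN10.
    rewrite -(ler_pM2l y0) => h.
    apply: (@le_trans _ _ (y * (x / y) ^+ 2 / 2)); last first.
      by rewrite le_eqVlt; apply/orP; left; apply/eqP; field; rewrite gt_eqF.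
    by rewrite mulrA ler_pM2r ?invr_gt0.
  - exact: cvg_cst.
  - rewrite -[X in _ --> X](mulr0 (x ^+ 2 / 2)); apply: cvgM; first exact: cvg_cst.
    apply/gtr0_cvgV0; last exact: cvg_id.
    by near=> y; near: y; apply: nbhs_pinfty_gt; rewrite num_real.
have [->|x0] := eqVneq x 0.
  by rewrite normr0 mulr0; under eq_fun do rewrite mul0r; exact: cvg_cst.
rewrite [X in _ --> X]mulrC; apply: cvgM; first exact: cvg_cst.
apply: (@cvg_comp _ _ _ (fun y => y / `|x|) (@atan R) _ +oo); last exact: cvgy_atan.
by apply: gt0_cvgMly; rewrite ?invr_gt0 ?normr_gt0 //; exact: cvg_id.
Unshelve. all: by end_near.
Qed.

Definition coulson_sum (a : seq R) (y : R) : R := \sum_(x <- a) coulson x y.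

(* [Q y] is the modulus of [\prod_(x <- a) (y + 'i * x)]. *)
Definition has_modulus (a : seq R) (Q : R -> R) : Prop :=
  forall y, 0 < y -> 0 < Q y /\ \prod_(x <- a) (y ^+ 2 + x ^+ 2) = Q y ^+ 2.

(** The term [ln y *+ size a] depends only on the order and cancels between graphs of the same
    order. *)
Lemma is_derive_coulson_sum a Q (y : R) : has_modulus a Q -> 0 < y ->
  is_derive y 1 (coulson_sum a) (ln (Q y) - ln y *+ size a).
Proof.
move=> /(_ y)HQ y0; have {HQ} [Q0 QE] := HQ y0.
have -> : ln (Q y) - ln y *+ size a = \sum_(x <- a) ln (1 + (x / y) ^+ 2) / 2.
  have -> : ln (Q y) = ln (Q y ^+ 2) / 2 by rewrite lnXn // mulr2n; field.
  have -> : ln y = ln (y ^+ 2) / 2 by rewrite lnXn // mulr2n; field.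
  rewrite -QE; elim: a {QE} => [|x a IH].
    by rewrite !big_nil ln1 mul0r mulr0n subr0.
  have y2 : 0 < y ^+ 2 by rewrite exprn_gt0.
  rewrite !big_cons -IH lnM ?posrE ?ltr_pwDl ?sqr_ge0 //; last first.
    by apply: prodr_gt0 => z _; rewrite ltr_pwDl ?sqr_ge0.
  have -> : 1 + (x / y) ^+ 2 = (y ^+ 2 + x ^+ 2) / y ^+ 2 by field; rewrite gt_eqF.
  rewrite ln_div ?posrE ?ltr_pwDl ?sqr_ge0 //= mulrS; ring.
elim: a {QE} => [|x a IH].
  rewrite big_nil (_ : coulson_sum _ = cst 0); first exact: is_derive_cst.
  by apply/funext => z; rewrite /coulson_sum big_nil.
rewrite big_cons (_ : coulson_sum _ = coulson x + coulson_sum a).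
  by apply: is_deriveD; exact: is_derive_coulson.
by apply/funext => z; rewrite /coulson_sum big_cons.
Qed.

(** [Y] tends to infinity, where [coulson_sum] tends to [pi / 2] times the energy, then [t] tends to
    0. One-sided control suffices at [t]: nonnegativity for [a], [coulson_near0] for [b]. *)
Lemma energy_lower_bound (a b : seq R) (delta : R) :
  (forall t Y : R, 0 < t <= 5^-1 -> 1 <= Y ->
     delta <= coulson_sum a Y - coulson_sum b Y
              - (coulson_sum a t - coulson_sum b t)) ->
  delta <= pi / 2 * (\sum_(x <- a) `|x| - \sum_(x <- b) `|x|).
Proof.
move=> H.
have cv l : coulson_sum l y @[y --> +oo] --> pi / 2 * \sum_(x <- l) `|x|.
  elim: l => [|x l IH].
    rewrite big_nil mulr0 (_ : coulson_sum _ = cst 0); first exact: cvg_cst.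
    by apply/funext => z; rewrite /coulson_sum big_nil.
  rewrite big_cons mulrDr (_ : coulson_sum _ = coulson x + coulson_sum l).
    by apply: cvgD => //; exact: cvgy_coulson.
  by apply/funext => z; rewrite /coulson_sum big_cons.
pose K := \sum_(x <- b) (3 * (1 + `|x|)).
have K0 : 0 <= K by apply: sumr_ge0 => x _; rewrite mulr_ge0 ?addr_ge0.
have small t : 0 < t -> t <= 5^-1 ->
    delta - t * K <= pi / 2 * (\sum_(x <- a) `|x| - \sum_(x <- b) `|x|).
  move=> t0 t5.
  rewrite mulrBr; apply: (cvgr_to_ge (cvgB (cv a) (cv b))).
  near=> Y; have Y1 : 1 <= Y by near: Y; apply: nbhs_pinfty_ge; rewrite num_real.
  have t2 : 0 < t ^+ 2 <= 5^-1 by apply/andP; split; nra.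
  have := H (t ^+ 2) Y t2 Y1.
  have : 0 <= coulson_sum a (t ^+ 2).
    by apply: sumr_ge0 => x _; apply: coulson_ge0; have [] := andP t2.
  have : coulson_sum b (t ^+ 2) <= t * K.
    rewrite mulr_sumr; apply: ler_sum => x _; rewrite mulrA [t * 3]mulrC.
    by apply: coulson_near0 => //; lra.
  rewrite [X in _ -> _ -> _ -> _ <= X](_ : _ = coulson_sum a Y - coulson_sum b Y) //; lra.
apply/ler_addgt0Pr => e e0.
pose t := Num.min 5^-1 (e / (K + 1)).
have K1 : 0 < K + 1 by rewrite ltr_wpDl.
have t0 : 0 < t by rewrite lt_min invr_gt0 divr_gt0 // ltr0n.
have /small : t <= 5^-1 by rewrite ge_min lexx.
have : t * K <= e.
  have : t <= e / (K + 1) by rewrite ge_min lexx orbT.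
  by rewrite ler_pdivlMr //; nra.
by move=> h /(_ t0) h2; lra.
Unshelve. all: by end_near.
Qed.

Section CompareEnergies.
Variables (a b : seq R) (P Q : R -> R).
Hypotheses (eq_size : size a = size b) (aP : has_modulus a P) (bQ : has_modulus b Q).
Let D (y : R) := coulson_sum a y - coulson_sum b y.
Let dD (y : R) := - ln (Q y / P y).

Let is_derive_D (y : R) : 0 < y -> is_derive y 1 D (dD y).
Proof.
move=> y0; have [P0 _] := aP y0; have [Q0 _] := bQ y0.
have -> : dD y = (ln (P y) - ln y *+ size a) - (ln (Q y) - ln y *+ size b).
  by rewrite /dD ln_div ?posrE // eq_size; ring.
exact: is_deriveB (is_derive_coulson_sum aP y0) (is_derive_coulson_sum bQ y0).
Qed.

(** From [ln x <= x - 1] at [x = Q y / P y]. *)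
Let dD_ge (y : R) : 0 < y -> 1 - Q y / P y <= dD y.
Proof.
move=> y0; have [P0 _] := aP y0; have [Q0 _] := bQ y0.
rewrite lerNr opprB -{1}[Q y / P y](subrK 1) [_ - 1 + 1]addrC.
by rewrite le_ln1Dx // ltrBrDl subrr divr_gt0.
Qed.

Let D_growth (c u v : R) : 0 < u <= v ->
  (forall y, u <= y <= v -> c <= 1 - Q y / P y) -> c * (v - u) <= D v - D u.
Proof.
move=> /andP[u0 uv] H; apply: (@le_growth _ dD) => // y /[dup] uyv /andP[uy _].
  by apply: is_derive_D; exact: lt_le_trans uy.
by apply: le_trans (H y uyv) (dD_ge _); exact: lt_le_trans uy.
Qed.

Let D_ndecr (u v : R) : 0 < u <= v ->
  (forall y, u <= y <= v -> 0 <= 1 - Q y / P y) -> D u <= D v.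
Proof. by move=> uv /(D_growth uv); rewrite mul0r subr_ge0. Qed.

Let energy_gt (delta : R) : 0 < delta ->
  (forall t Y : R, 0 < t <= 5^-1 -> 1 <= Y -> delta <= D Y - D t) ->
  \sum_(x <- b) `|x| < \sum_(x <- a) `|x|.
Proof.
move=> delta0 /energy_lower_bound /(lt_le_trans delta0).
by rewrite pmulr_rgt0 ?subr_gt0 // divr_gt0 // pi_gt0.
Qed.

Lemma energy_le : (forall y, 0 < y -> Q y <= P y) ->
  \sum_(x <- b) `|x| <= \sum_(x <- a) `|x|.
Proof.
move=> QP; rewrite -subr_ge0 -(@pmulr_rge0 _ (pi / 2)); last first.
  by rewrite divr_gt0 // pi_gt0.
apply: energy_lower_bound => t Y /andP[t0 t5] Y1; rewrite -/(D Y) -/(D t).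
rewrite subr_ge0; apply: D_ndecr => [|y /andP[ty _]]; first by rewrite t0; lra.
have y0 := lt_le_trans t0 ty; have [P0 _] := aP y0.
by rewrite subr_ge0 ler_pdivrMr // mul1r QP.
Qed.

(** Pointwise strictness alone would become weak in the limit; the growth of [D] on the fixed
    interval [[5^-1, 1]] is a positive gap independent of [t] and [Y]. *)
Lemma energy_lt : (forall y, 0 < y -> Q y < P y) ->
  \sum_(x <- b) `|x| < \sum_(x <- a) `|x|.
Proof.
move=> QP; have ratio y : 0 < y -> 0 < 1 - Q y / P y.
  by move=> y0; have [P0 _] := aP y0; rewrite subr_gt0 ltr_pdivrMr // mul1r QP.
have D51 : D 5^-1 < D 1.
  apply: (@lt_growth _ dD) => [|y /andP[y5 _]|y /andP[y5 _]]; first by lra.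
    by apply: is_derive_D; lra.
  by apply: (lt_le_trans (ratio y _) (dD_ge _)); lra.
apply: (@energy_gt (D 1 - D 5^-1)) => [|t Y /andP[t0 t5] Y1]; first by rewrite subr_gt0.
apply: lerB; apply: D_ndecr => [|y /andP[ty _]].
- by rewrite ltr01.
- by apply/ltW/ratio; lra.
- by rewrite t0.
- by apply/ltW/ratio/(lt_le_trans t0).
Qed.

Lemma energy_lt_rival :
  (forall y, 0 < y <= 1 -> 0 <= 1 - Q y / P y) ->
  (forall y, 5^-1 <= y <= 2^-1 -> 48^-1 <= 1 - Q y / P y) ->
  (forall y, 2^-1 <= y <= 3 / 5 -> 64^-1 <= 1 - Q y / P y) ->
  (forall y, 1 <= y -> - ((y ^- 3 - y ^- 5) / 36) <= 1 - Q y / P y) ->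
  \sum_(x <- b) `|x| < \sum_(x <- a) `|x|.
Proof.
move=> H1 H2 H3 H4.
(* The gain on [1/5, 3/5] minus the loss on [1, +oo): the tail bound has
   antiderivative [E] below, with [E 1 = 144^-1] and [E >= 0]. *)
pose delta : R := 48^-1 * (2^-1 - 5^-1) + 64^-1 * (3 / 5 - 2^-1) - 144^-1.
apply: (@energy_gt delta) => [|t Y /andP[t0 t5] Y1]; first by rewrite /delta; lra.
have S1 : D t <= D 5^-1.
  by apply: D_ndecr => [|y /andP[ty ?]]; [rewrite t0 | apply: H1; rewrite (lt_le_trans t0 ty); lra].
have S2 : 48^-1 * (2^-1 - 5^-1) <= D 2^-1 - D 5^-1 by apply: D_growth => //; lra.
have S3 : 64^-1 * (3 / 5 - 2^-1) <= D (3 / 5) - D 2^-1 by apply: D_growth => //; lra.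
have S4 : D (3 / 5) <= D 1.
  by apply: D_ndecr => [|y ?]; [lra | apply: H1; lra].
pose E y : R := 72^-1 * y^-1 ^+ 2 - 144^-1 * y^-1 ^+ 4.
have dE (y : R) : 0 < y -> is_derive y 1 E (- ((y ^- 3 - y ^- 5) / 36)).
  move=> y0; have yn0 : y != 0 by rewrite gt_eqF.
  have Di := @is_deriveV R id y 1 1 yn0 (is_derive_id y 1).
  have := is_deriveB (is_deriveM (is_derive_cst (72^-1 : R) y 1) (is_deriveX 2 Di))
                     (is_deriveM (is_derive_cst (144^-1 : R) y 1) (is_deriveX 4 Di)).
  move/is_derive_eq; apply; rewrite /GRing.scale /=.
  transitivity (72^-1 * (2 * y^-1 ^+ 1 * (- y ^- 2 * 1)) + y^-1 ^+ 2 * 0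
    - (144^-1 * (4 * y^-1 ^+ 3 * (- y ^- 2 * 1)) + y^-1 ^+ 4 * 0)); first by [].
  by field.
have S5 : D 1 - E 1 <= D Y - E Y.
  rewrite -subr_ge0 -(mul0r (Y - 1)).
  apply: (@le_growth (fun y => D y - E y)
    (fun y => dD y - (- ((y ^- 3 - y ^- 5) / 36)))) => // y /andP[y1 _].
    by apply: is_deriveB; [apply: is_derive_D|apply: dE]; lra.
  by rewrite subr_ge0; apply: le_trans (H4 y y1) (dD_ge _); lra.
have E1 : E 1 = 144^-1 by rewrite /E invr1 !expr1n; lra.
have EY : 0 <= E Y.
  have Y0 : 0 < Y := lt_le_trans ltr01 Y1.
  have : 0 < Y^-1 <= 1 by rewrite invr_gt0 Y0 invf_le1.
  rewrite /E (exprM _ 2 2) => /andP[w0 w1].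
  have : 0 <= Y^-1 ^+ 2 <= 1 by rewrite exprn_ge0 ?exprn_ile1 // ltW.
  by move: (Y^-1 ^+ 2) => w /andP[? ?]; nra.
by rewrite /delta; lra.
Qed.

End CompareEnergies.

End Coulson.

(** * Determinants and spectra of trees *)

(** Expansion along row [v]: off the diagonal, column [v] may be arbitrary, since the cofactor does
    not see it. *)
Lemma det_unit_row (R : comNzRingType) n (A B : 'M[R]_n) (c : R) (v : 'I_n) :
  (forall j, A v j = c *+ (j == v)) -> (forall j, B v j = (j == v)%:R) ->
  (forall i j, i != v -> j != v -> A i j = B i j) -> \det A = c * \det B.
Proof.
move=> Av Bv AB; rewrite (expand_det_row A v) (expand_det_row B v).
rewrite [in LHS](bigD1 v) //= [in RHS](bigD1 v) //=.
rewrite !big1 => [|j /negPf jv|j /negPf jv]; last 2 first.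
- by rewrite Bv jv mul0r.
- by rewrite Av jv mulr0n mul0r.
rewrite !addr0 Av Bv eqxx mulr1n mul1r; congr (_ * _); rewrite /cofactor.
by congr (_ * \det _); apply/matrixP => i j; rewrite !mxE AB // eq_sym neq_lift.
Qed.

(** * Vertex deletion in determinants of induced subgraphs *)

Section InducedDeterminant.
Variables (R : comNzRingType) (n : nat) (z w : R) (E : rel nat).
Hypothesis E_sym : symmetric E.

(* Vertices outside [P] contribute a trivial diagonal block, so that vertex
   deletion does not change the size of the matrix. *)
Definition ind_mx (P : pred nat) : 'M[R]_n := \matrix_(i, j)
  if P i && P j then z *+ (i == j) - w *+ E i j else (i == j)%:R.

Definition ind_det P := \det (ind_mx P).

Lemma eq_ind_det P P' : (forall i, (i < n)%N -> P i = P' i) -> ind_det P = ind_det P'.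
Proof. by move=> PP'; congr (\det _); apply/matrixP => i j; rewrite !mxE !PP'. Qed.

Lemma ind_det0 : ind_det pred0 = 1.
Proof. by rewrite -(det1 R n); congr (\det _); apply/matrixP => i j; rewrite !mxE. Qed.

Lemma ind_det_isolated (P : pred nat) (v : 'I_n) : P v ->
  (forall j, P j -> ~~ E v j) -> ind_det P = z * ind_det (fun i => P i && (i != v)).
Proof.
move=> Pv Nv; apply: (@det_unit_row _ _ _ _ _ v) => [j|j|i j iv jv]; rewrite !mxE.
- case Pj: (P j); rewrite ?Pv /= ?andbF eq_sym; last first.
    case: eqP => [jv|_]; last by rewrite !mulr0n. by rewrite jv Pv in Pj.
  by rewrite (negPf (Nv j Pj)) mulr0n subr0.
- by rewrite eqxx andbF /= eq_sym.
- have -> : (i : nat) != v by []. have -> : (j : nat) != v by [].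
  by rewrite !andbT.
Qed.

(** Row [v] is [z e_v - w e_u], and the determinant is linear in it. The first part deletes [v]. In
    the second, rows [u] and [v] are swapped; row [u] is then [e_u], so column [u] can be cleared,
    and column [v] keeps the single entry [- w] because [u] is the only neighbour of [v]. *)
Lemma ind_det_leaf (P : pred nat) (v u : 'I_n) : P v -> P u -> u != v -> E v u ->
  (forall j, P j -> E v j -> j = u) ->
  ind_det P = z * ind_det (fun i => P i && (i != v))
    - w ^+ 2 * ind_det (fun i => [&& P i, i != v & i != u]).
Proof.
move=> Pv Pu uv Evu Nv.
have Evv : E v v = false.
  by apply/negP => /(Nv _ Pv)/val_inj/eqP; rewrite eq_sym (negPf uv).
set M := ind_mx P.
have Mv j : M v j = z *+ (j == v) - w *+ (j == u).
  rewrite !mxE Pv /=; case: (eqVneq j u) => [->|ju]; first by rewrite Pu Evu eq_sym.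
  case Pj: (P j); last first.
    rewrite mulr0n subr0; case: (eqVneq j v) => [jv|jv]; first by rewrite jv Pv in Pj.
    by rewrite mulr0n.
  rewrite eq_sym; congr (_ - w *+ nat_of_bool _); apply/negP => /(Nv _ Pj)/val_inj.
  by apply/eqP.
pose M1 : 'M[R]_n := \matrix_(i, j) if i == v then (j == v)%:R else M i j.
pose M2 : 'M[R]_n := \matrix_(i, j) if i == v then (j == u)%:R else M i j.
have -> : ind_det P = z * \det M1 + (- w) * \det M2.
  apply: (determinant_multilinear (i0 := v)).
  - apply/rowP => j; rewrite [LHS]mxE Mv ![in RHS]mxE eqxx.
    by rewrite mulNr !mulr_natr.
  - by apply/matrixP => i j; rewrite !mxE eq_sym (negPf (neq_lift _ _)).
  - by apply/matrixP => i j; rewrite !mxE eq_sym (negPf (neq_lift _ _)).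
have -> : \det M1 = ind_det (fun i => P i && (i != v)).
  rewrite -[RHS]mul1r; apply: (@det_unit_row _ _ _ _ _ v) => [j|j|i j iv jv]; rewrite !mxE.
  - by rewrite eqxx.
  - by rewrite eqxx andbF /= eq_sym.
  - rewrite (negPf iv); have -> : (i : nat) != v by []. have -> : (j : nat) != v by [].
    by rewrite !andbT.
pose M3 := xrow u v M2.
have -> : \det M2 = - \det M3.
  by rewrite /M3 xrowE det_mulmx det_perm odd_tperm uv mulN1r opprK.
have M3E i j : M3 i j = if i == u then (j == u)%:R else if i == v then M u j else M i j.
  rewrite /M3 /xrow !mxE; case: (eqVneq i u) => [->|iu]; first by rewrite tpermL eqxx.
  case: (eqVneq i v) => [->|iv]; first by rewrite tpermR (negPf uv).
  by rewrite tpermD 1?eq_sym // eq_sym (negPf iv).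
pose M4 : 'M[R]_n := \matrix_(i, j)
  if i == u then (j == u)%:R else if j == u then 0 else M3 i j.
have -> : \det M3 = \det M4.
  rewrite -[RHS]mul1r; apply: (@det_unit_row _ _ _ _ _ u) => [j|j|i j iu ju].
  - by rewrite M3E eqxx.
  - by rewrite mxE eqxx.
  - by rewrite [RHS]mxE (negPf iu) (negPf ju).
rewrite -[\det M4]det_tr.
suff -> : \det M4^T = - w * ind_det (fun i => [&& P i, i != v & i != u]) by ring.
rewrite -[ind_det _]det_tr.
apply: (@det_unit_row _ _ _ _ _ v) => [i|i|i j iv jv].
- rewrite [LHS]mxE [LHS]mxE M3E [v == u]eq_sym (negPf uv).
  case: (eqVneq i u) => [->|iu]; first by rewrite (negPf uv).
  case: (eqVneq i v) => [_|iv].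
    rewrite !mxE Pu Pv (negPf uv) E_sym Evu. by rewrite mulr0n mulr1n sub0r mulr1n.
  rewrite mulr0n !mxE Pv andbT (negPf iv); case: ifP => // Pi.
  rewrite mulr0n sub0r; apply/eqP; rewrite oppr_eq0; apply/eqP.
  rewrite E_sym; case Evi: (E v i) => //.
  by move/(Nv _ Pi)/val_inj: Evi iu => ->; rewrite eqxx.
- by rewrite !mxE eqxx !andbF.
- rewrite [LHS]mxE [LHS]mxE M3E ![in RHS]mxE.
  have iv' : (i : nat) != v by []. have jv' : (j : nat) != v by [].
  rewrite iv' jv' /=; case: (eqVneq j u) => [->|ju].
    by rewrite eqxx !andbF eq_sym.
  case: (eqVneq i u) => [->|iu]; first by rewrite eqxx !andbF (negPf ju).
  have -> : (i : nat) != u by []. have -> : (j : nat) != u by [].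
  by rewrite !andbT (negPf jv) !mxE.
Qed.

Hypothesis w2 : w ^+ 2 = - 1.

(** The leaf rule at the last vertex gives the Fibonacci recurrence in [k]. If [t] is outside [P],
    the new path is a component of its own, whence the value 0; this covers a fresh path as well as
    one whose attaching vertex has been deleted. *)
Lemma ind_det_path (P P' : pred nat) (b k t : nat) : (b + k <= n)%N ->
  (forall i, P i -> (i < b)%N) ->
  (forall j, (0 < k)%N -> P j -> E b j = (j == t)) ->
  (forall i j, (b < i < b + k)%N -> (j < i)%N -> E i j = (j == i.-1)) ->
  (forall i, ~~ E i i) ->
  (forall i, (i < n)%N -> P' i = P i || (b <= i < b + k)%N) ->
  ind_det P' = fibp z k.+1 * ind_det P
    + fibp z k * (if P t then ind_det (fun i => P i && (i != t)) else 0).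
Proof.
move=> bk Pb Eb Ei Eirr /eq_ind_det ->.
pose D j := ind_det (fun i => P i || (b <= i < b + j)%N).
pose Dt := if P t then ind_det (fun i => P i && (i != t)) else 0.
have D0 : D 0%N = ind_det P by apply: eq_ind_det => i _; rewrite addn0; lia.
rewrite -D0 -/Dt -/(D k).
suff: forall j, ((j <= k)%N -> D j = fibp z j.+1 * D 0%N + fibp z j * Dt) /\
  ((j < k)%N -> D j.+1 = fibp z j.+2 * D 0%N + fibp z j.+1 * Dt).
  by move=> /(_ k) [+ _]; apply.
elim=> [|j [IH1 IH2]]; split.
- by move=> _; rewrite !fibpE mul1r mul0r addr0.
- move=> k0; have bn : (b < n)%N by lia.
  have Pb' : P b = false by apply/negP => /Pb; lia.
  rewrite !fibpE mul1r; pose v := Ordinal bn.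
  rewrite /D /Dt; case: ifP => Pt.
    have tb := Pb _ Pt; have tn : (t < n)%N by lia.
    rewrite (@ind_det_leaf _ v (Ordinal tn)) /=; first last.
    - move=> i /orP[Pi|ib]; first by rewrite Eb // => /eqP.
      by rewrite (_ : i = b) ?(negPf (Eirr b)) //; lia.
    - by rewrite Eb.
    - by apply/eqP => -[]; lia.
    - by rewrite Pt.
    - by lia.
    - rewrite w2 mulN1r opprK; congr (z * _ + _); apply: eq_ind_det => i _.
        by have := Pb i; case: (P i) => //=; lia.
      by have := Pb i; case: (P i) => //=; lia.
  rewrite (@ind_det_isolated _ v) /=; last 2 first.
  - by lia.
  - move=> i /orP[Pi|ib]; last by rewrite (_ : i = b) ?Eirr //; lia.
    by rewrite Eb //; apply: contraFN Pt => /eqP <-.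
  rewrite addr0; congr (z * _); apply: eq_ind_det => i _.
  by have := Pb i; case: (P i) => //=; lia.
- exact: IH2.
- move=> jk; have v_n : (b + j.+1 < n)%N by lia.
  have u_n : (b + j < n)%N by lia.
  have hE i : (i < b + j.+1)%N -> E (b + j.+1)%N i = (i == b + j)%N.
    by move=> ib; rewrite Ei ?addnS //; lia.
  have -> : D j.+2 = z * D j.+1 + D j.
    rewrite {1}/D (@ind_det_leaf _ (Ordinal v_n) (Ordinal u_n)) /=.
    - rewrite w2 mulN1r opprK; congr (z * _ + _); apply: eq_ind_det => i _.
        by have := Pb i; case: (P i) => //=; lia.
      by have := Pb i; case: (P i) => //=; lia.
    - by apply/orP; right; lia.
    - by apply/orP; right; lia.
    - by apply/eqP => -[]; lia.
    - by rewrite hE //; lia.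
    - move=> i Pi; have [ij|ij] := ltnP i (b + j.+1); first by rewrite hE // => /eqP.
      have -> : i = (b + j.+1)%N by move: Pi => /orP[/Pb|]; lia.
      by rewrite (negPf (Eirr _)).
  rewrite IH1 ?IH2; [|lia|lia].
  by rewrite (fibpSS _ j.+1) (fibpSS _ j); ring.
Qed.

End InducedDeterminant.

(* [jump_arc p q r s i j]: [j] is the parent of [i] when every vertex [i > 0]
   has parent [i.-1], except that [p] is attached to [q] and [r] to [s]. *)
Definition jump_arc (p q r s i j : nat) : bool :=
  [|| (i == p) && (j == q), (i == r) && (j == s)
    | [&& 0 < i, i != p, i != r & j == i.-1]]%N.

Definition jump_adj p q r s : rel nat :=
  fun i j => jump_arc p q r s i j || jump_arc p q r s j i.

(* The path formed by the leg [a], the path between the branch vertices and the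
   leg [c] comes first, with branch vertices [a] and [a + d]; then come the
   leg [b], hanging from [a], and the last leg, hanging from [a + d]. *)
Definition lab_adj (a b d c : nat) : rel nat :=
  let p := (a + d + c).+1 in jump_adj p a (p + b) (a + d).

Lemma jump_adj_sym p q r s : symmetric (jump_adj p q r s).
Proof. by move=> i j; rewrite /jump_adj orbC. Qed.

Lemma jump_adj_lt p q r s i j : (q < p)%N -> (s < r)%N -> (p < r)%N -> (j < i)%N ->
  jump_adj p q r s i j = (j == if i == p then q else if i == r then s else i.-1).
Proof.
move=> qp sr pr ji.
have arcF : jump_arc p q r s j i = false.
  rewrite /jump_arc; have [jp|_] := eqVneq j p.
    have [|_] := eqVneq i q; first by lia.
    by have [|_] := eqVneq j r; rewrite /=; lia.
  by have [jr|_] := eqVneq j r; rewrite /=; lia.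
rewrite /jump_adj arcF orbF /jump_arc.
have [->|ip] := eqVneq i p; first by rewrite (ltn_eqF pr) /= andbF orbF.
have [->|ir] := eqVneq i r; first by rewrite /= andbF orbF.
by rewrite /= (leq_ltn_trans (leq0n j) ji).
Qed.

Lemma jump_adj_irr p q r s i : (q < p)%N -> (s < r)%N -> ~~ jump_adj p q r s i i.
Proof.
move=> qp sr; rewrite /jump_adj orbb /jump_arc.
have [->|_] := eqVneq i p; first by rewrite /= andbF orbF; lia.
have [->|_] := eqVneq i r; first by rewrite /=; lia.
by rewrite /=; lia.
Qed.

(** * The determinant of a labelled tree *)

Section TreeDeterminant.
Variables (R : comNzRingType) (z w : R) (a b d c e : nat).
Hypotheses (w2 : w ^+ 2 = - 1) (b0 : (0 < b)%N) (d0 : (0 < d)%N).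

Let n := (a + b + d + c + e).+1.
Let p := (a + d + c).+1.
Local Notation r := (fibp z).
Local Notation det P := (ind_det n z w (lab_adj a b d c) P).

Let parent i := (if i == p then a else if i == p + b then a + d else i.-1)%N.

Let adjE i j : (j < i)%N -> lab_adj a b d c i j = (j == parent i).
Proof. by apply: jump_adj_lt; lia. Qed.

Let path_rule (P P' : pred nat) (m k t : nat) : (m + k <= n)%N ->
  (forall i, P i -> (i < m)%N) ->
  ((0 < m)%N -> (0 < k)%N -> parent m = t) ->
  (forall i, (m < i < m + k)%N -> parent i = i.-1) ->
  (forall i, (i < n)%N -> P' i = P i || (m <= i < m + k)%N) ->
  det P' = r k.+1 * det P + r k * (if P t then det (fun i => P i && (i != t)) else 0).
Proof.
move=> mk Pm pm pi; apply: ind_det_path => //; first exact: jump_adj_sym.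
- by move=> j k0 /Pm jm; rewrite adjE // pm //; lia.
- by move=> i j mi ji; rewrite adjE // pi.
- by move=> i; apply: jump_adj_irr; lia.
Qed.

Let parent_pred i : i != p -> (i != p + b)%N -> parent i = i.-1.
Proof. by rewrite /parent => /negPf-> /negPf->. Qed.

Let det_path m : (m <= p)%N -> det (fun i => i < m)%N = r m.+1.
Proof.
move=> mp; rewrite (@path_rule pred0 _ 0%N m 0%N) //=.
- by rewrite ind_det0 mulr0 addr0 mulr1.
- by rewrite /n; lia.
- by move=> i im; rewrite parent_pred //; lia.
Qed.

Let det_path1 q m : (q < m <= p)%N ->
  det (fun i => (i < m) && (i != q))%N = r (m - q) * r q.+1.
Proof.
move=> qm; rewrite (@path_rule (fun i => i < q)%N _ q.+1 (m - q.+1)%N q) //=.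
- by rewrite ltnn mulr0 addr0 det_path; [congr (r _ * _)|]; lia.
- by rewrite /n; lia.
- by move=> i; exact: leqW.
- by move=> _ k0; rewrite parent_pred //; lia.
- by move=> i im; rewrite parent_pred //; lia.
- by move=> i _; lia.
Qed.

Let det_path2 : det (fun i => [&& i < p, i != (a + d) & i != a])%N
  = r c.+1 * (r d * r a.+1).
Proof.
rewrite (@path_rule (fun i => (i < a + d) && (i != a))%N _ (a + d).+1 c (a + d)%N) //=.
- rewrite ltnn mulr0 addr0 det_path1; last by lia.
  by congr (_ * (r _ * _)); lia.
- by rewrite /n; lia.
- by move=> i; lia.
- by move=> _ k0; rewrite parent_pred //; lia.
- by move=> i im; rewrite parent_pred //; lia.
- by move=> i _; lia.
Qed.

(** The tree is built in label order: the spine, the leg [b] at [a], the leg [e] at [a + d]. Each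
    leg costs one [path_rule], so the spine is needed whole and with one or both branch vertices
    deleted. *)
Lemma lab_det : det predT = tree_poly z a b d c e.
Proof.
have leg (P : pred nat) : (forall i, P i -> i < p)%N -> P a ->
   det (fun i => P i || (p <= i < p + b)%N)
   = r b.+1 * det P + r b * det (fun i => P i && (i != a)).
  move=> Pp Pa; rewrite (@path_rule P _ p b a) ?Pa //.
  - by rewrite /n; lia.
  - by move=> _ _; rewrite /parent eqxx.
  - by move=> i im; rewrite parent_pred //; lia.
rewrite (@path_rule (fun i => i < p + b)%N _ (p + b)%N e (a + d)%N) //=.
- rewrite ifT; last by lia.
  have -> : det (fun i => i < p + b)%N = r b.+1 * r p.+1 + r b * (r (p - a)%N * r a.+1).
    rewrite -(@det_path p) // -(@det_path1 a p); last by lia.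
    rewrite -leg //; last by lia.
    by apply: eq_ind_det => i _; lia.
  have -> : det (fun i => (i < p + b) && (i != a + d))%N =
     r b.+1 * (r (p - (a + d))%N * r (a + d).+1) + r b * (r c.+1 * (r d * r a.+1)).
    rewrite -(@det_path1 (a + d)%N p) -?det_path2; last by lia.
    have -> : det (fun i => [&& i < p, i != a + d & i != a])%N
      = det (fun i => ((i < p) && (i != a + d)) && (i != a))%N.
      by apply: eq_ind_det => i _; rewrite andbA.
    rewrite -(leg (fun i => (i < p) && (i != a + d))%N); [|lia|lia].
    by apply: eq_ind_det => i _; lia.
  rewrite /tree_poly two_legsE !linrecE -/(fibp z).
  have -> : (p - a = (c + d).+1)%N by lia.
  have -> : (p - (a + d) = c.+1)%N by lia.
  have -> : p.+1 = (c + (a + d).+1).+1 by lia.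
  by rewrite !fibpD; ring.
- by rewrite /n; lia.
- by move=> _ _; rewrite /parent eqxx ifF //; lia.
- by move=> i im; rewrite parent_pred //; lia.
- by move=> i ; rewrite /n; lia.
Qed.

End TreeDeterminant.

(** * The spectrum, the energy and the modulus of a graph *)

Section Spectrum.
Variable R : rcfType.
Local Notation C := (R[i]).
Local Notation I := ('i%C : C).

(** The adjacency matrix is real and symmetric, so pairing an eigenvector with its conjugate forces
    [x] to equal its own conjugate. *)
Lemma eigenvalue_real (G : sgraph) (x : C) :
  x \in eigenvalues R G -> x = ((complex.Re x)%:C)%C.
Proof.
set A := adjacency_mx R G => xG.
have /eigenvalueP[v vA v0] : eigenvalue A x.
  by rewrite eigenvalue_root_char eigenvaluesP root_prod_XsubC.
pose vc := map_mx (@conjc R) v.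
have Ac : map_mx (@conjc R) A = A.
  by apply/matrixP => i j; rewrite !mxE rmorph_nat.
have At : A^T = A by apply/matrixP => i j; rewrite !mxE adj_sym.
have vcA : vc *m A = (x^*)%C *: vc by rewrite -Ac -map_mxM vA map_mxZ.
have AvT : A *m vc^T = (x^*)%C *: vc^T by rewrite -At -trmx_mul vcA linearZ.
have E : x *: (v *m vc^T) = (x^*)%C *: (v *m vc^T).
  by rewrite scalemxAl -vA -mulmxA AvT scalemxAr.
have n0 : (v *m vc^T) 0 0 != 0.
  have [j vj] : exists j, v 0 j != 0.
    by apply/rV0Pn.
  rewrite mxE gt_eqF // (bigD1 j) //= ltr_pwDl //.
    by rewrite !mxE -sqr_normc exprn_gt0 // normr_gt0.
  by apply: sumr_ge0 => k _; rewrite !mxE -sqr_normc exprn_ge0.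
have /matrixP/(_ 0 0) := E; rewrite mxE [RHS]mxE => /(mulIf n0).
case: (x) => a b [] bb; congr Complex; lra.
Qed.

Definition real_spectrum (G : sgraph) : seq R := map (@complex.Re R) (eigenvalues R G).

Lemma eigenvaluesE G : eigenvalues R G = [seq (x%:C)%C | x <- real_spectrum G].
Proof.
by rewrite -map_comp -[LHS]map_id; apply/eq_in_map => x /eigenvalue_real.
Qed.

Lemma energyE G : energy R G = \sum_(x <- real_spectrum G) `|x|.
Proof.
rewrite /energy eigenvaluesE big_map; apply: eq_bigr => x _.
by rewrite normc_def /= expr0n addr0 sqrtr_sqr.
Qed.

Lemma size_real_spectrum G : size (real_spectrum G) = #|G|.
Proof.
rewrite size_map; apply: succn_inj.
by rewrite -(size_char_poly (adjacency_mx R G)) eigenvaluesP size_prod_XsubC.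
Qed.

Lemma char_poly_horner n (A : 'M[C]_n) x : (char_poly A).[x] = \det (x%:M - A).
Proof.
rewrite /char_poly -horner_evalE -det_map_mx; congr (\det _).
by apply/matrixP => i j; rewrite !mxE /= /horner_eval !hornerE hornerMn hornerX.
Qed.

(** Since [y + i A = - i (i y - A)], this is the characteristic polynomial at [i y], with one factor
    [- i] for each root. *)
Lemma prod_spectrum G (y : R) :
  \prod_(x <- real_spectrum G) ((y%:C)%C + I * (x%:C)%C)
  = \det (((y%:C)%C)%:M + I *: adjacency_mx R G).
Proof.
have I2 : I * I = -1 by rewrite -expr2 sqr_i.
have -> : ((y%:C)%C)%:M + I *: adjacency_mx R G
    = (- I) *: ((I * (y%:C)%C)%:M - adjacency_mx R G).
  rewrite scalerBr scale_scalar_mx mulrA mulNr I2 opprK mul1r scaleNr opprK //.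
rewrite detZ -char_poly_horner eigenvaluesP eigenvaluesE -size_real_spectrum.
elim: (real_spectrum G) => [|x s IH] /=; first by rewrite !big_nil mul1r hornerC.
rewrite !big_cons IH hornerM exprS mulrACA; congr (_ * _).
by rewrite hornerXsubC mulrBr mulrA mulNr I2 opprK mul1r mulNr opprK.
Qed.

Lemma det_adjacency (G : sgraph) n (h : 'I_n -> G) (E : rel nat) (y : C) :
  bijective h -> (forall i j, adj (h i) (h j) = E i j) ->
  \det (y%:M + I *: adjacency_mx R G) = ind_det n y (- I) E predT.
Proof.
move=> hb hE.
have nE : n = #|G| by rewrite -(bij_eq_card hb) card_ord.
subst n.
have sigma_inj : injective (fun i => enum_rank (h i)).
  by move=> i j /enum_rank_inj; exact: bij_inj.
pose s := perm sigma_inj.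
have -> : ind_det #|G| y (- I) E predT =
   \det (row_perm s (col_perm s (y%:M + I *: adjacency_mx R G))).
  congr (\det _); apply/matrixP => i j; rewrite !mxE !permE !enum_rankK hE.
  rewrite (inj_eq sigma_inj) -mulNrn opprK mulr_natr //.
rewrite row_permE col_permE !det_mulmx !det_perm odd_permV.
by rewrite mulrA mulrC mulrA -signr_addb addbb mul1r.
Qed.

End Spectrum.

Lemma fibp_rmorph (R S : comNzRingType) (f : {rmorphism R -> S}) y k :
  f (fibp y k) = fibp (f y) k.
Proof.
suff [] : f (fibp y k) = fibp (f y) k /\ f (fibp y k.+1) = fibp (f y) k.+1 by [].
elim: k => [|k [IH1 IH2]]; first by rewrite !fibpE rmorph0 rmorph1.
by split=> //; rewrite !fibpSS rmorphD rmorphM IH1 IH2.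
Qed.

Lemma tree_poly_rmorph (R S : comNzRingType) (f : {rmorphism R -> S}) y a b d c e :
  (0 < d)%N -> f (tree_poly y a b d c e) = tree_poly (f y) a b d c e.
Proof.
case: d => // d _; rewrite /tree_poly /two_legs !linrecE.
by rewrite !(rmorphD, rmorphM) !fibp_rmorph.
Qed.

(** At real [y] the determinant is real, so its square is its product with its conjugate, which
    pairs [y + i x] with [y - i x]. *)
Lemma has_modulus_tree (R : realType) (G : sgraph) a b d c e
    (h : 'I_(a + b + d + c + e).+1 -> G) :
  bijective h -> (0 < b)%N -> (0 < d)%N ->
  (forall i j, adj (h i) (h j) = lab_adj a b d c i j) ->
  (forall y : R, 0 < y -> 0 < tree_poly y a b d c e) ->
  has_modulus (real_spectrum R G) (fun y => tree_poly y a b d c e).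
Proof.
move=> hb b0 d0 hE Q0 y y0; split; first exact: Q0.
have := det_adjacency (y%:C)%C hb hE.
rewrite lab_det //; last by rewrite sqrrN sqr_i.
rewrite -prod_spectrum -(tree_poly_rmorph (real_complex R)) //= => E.
apply: (@complexI R).
rewrite rmorphXn /= [RHS]expr2 -{2}(conjc_real (tree_poly _ _ _ _ _ _)) -E.
rewrite !rmorph_prod -big_split /=; apply: eq_bigr => x _.
by congr Complex; rewrite /=; ring.
Qed.

(** * Labelling the trees with two branch vertices *)

Local Close Scope ring_scope.

Definition labelled (n : nat) (E : rel nat) (G : sgraph) : Prop :=
  exists h : 'I_n -> G, bijective h /\ forall i j, adj (h i) (h j) = E i j.

Lemma labelled_iso n E (G H : sgraph) :
  labelled n E G -> labelled n E H -> isomorphic G H.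
Proof.
move=> [g [[g' gK g'K] gE]] [h [hb hE]]; exists (h \o g'); split.
  by apply: bij_comp => //; exists g.
by move=> x y /=; rewrite hE -gE !g'K.
Qed.

Lemma labelled_iso_trans n E (G H : sgraph) :
  labelled n E G -> isomorphic H G -> labelled n E H.
Proof.
move=> [g [gb gE]] [f [[f' fK f'K] fE]]; exists (f' \o g); split.
  by apply: bij_comp => //; exists f.
by move=> x y /=; rewrite -fE !f'K gE.
Qed.

Lemma labelled_relabel n E E' (G : sgraph) (f : nat -> nat) :
  (forall i, i < n -> f i < n) ->
  (forall i j, i < n -> j < n -> f i = f j -> i = j) ->
  (forall i j, i < n -> j < n -> E' (f i) (f j) = E i j) ->
  labelled n E G -> labelled n E' G.
Proof.
move=> fn f_inj fE [h [hb hE]].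
pose F (i : 'I_n) := Ordinal (fn i (ltn_ord i)).
have F_inj : injective F.
  by move=> i j [] /f_inj ij; apply/val_inj/ij.
have [F' FK F'K] := injF_bij F_inj.
exists (h \o F'); split; first by apply: bij_comp => //; exists F.
move=> i j /=; rewrite hE -fE //.
by rewrite -[f (F' i)]/(val (F (F' i))) -[f (F' j)]/(val (F (F' j))) !F'K.
Qed.

(** * Greedy depth-first orders of a tree *)

Section DepthFirst.
Variable G : sgraph.
Hypotheses (G_conn : connected_graph G) (G_acyclic : acyclic_graph G).

Definition dfs_list (x0 : G) (l : seq G) : Prop :=
  [/\ uniq l, 0 < size l, nth x0 l 0 = x0 &
      forall i, 0 < i < size l -> exists2 j, j < i &
        (forall k, k < i -> adj (nth x0 l i) (nth x0 l k) = (k == j)) /\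
        (j != i.-1 -> forall w, w \notin take i l -> ~~ adj (nth x0 l i.-1) w)].

(** Listed vertices are connected through their parents, so two distinct listed neighbours of [w]
    would be joined by a path inside [l], which [w] would close to a cycle. *)
Lemma dfs_unique_neighbour x0 l w a b : dfs_list x0 l -> w \notin l ->
  a \in l -> b \in l -> adj w a -> adj w b -> a = b.
Proof.
move=> [l_uniq l0 lx0 lP] wl al bl wa wb.
pose e (x y : G) := [&& adj x y, x \in l & y \in l].
have e_sym : connect_sym e.
  by apply: sym_connect_sym => x y; rewrite /e adj_sym; congr (_ && _); rewrite andbC.
have e_root i : i < size l -> connect e (nth x0 l 0) (nth x0 l i).
  elim/ltn_ind: i => i IH il; case: (posnP i) => [->//|i0].
  have [|j ji [adj_ij _]] := lP i; first by rewrite i0.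
  apply: connect_trans (IH j ji (ltn_trans ji il)) _; apply: connect1.
  by rewrite /e adj_sym adj_ij // eqxx !mem_nth // (ltn_trans ji).
have /connectP[p0 p0P p0b] : connect e a b.
  rewrite -(nth_index x0 al) -(nth_index x0 bl).
  by apply: (connect_trans (y := nth x0 l 0)); [rewrite e_sym|]; apply: e_root; rewrite index_mem.
case: (eqVneq a b) => // ab.
case/shortenP: p0P p0b => p pP p_uniq _ pb.
have p_l : all [in l] (a :: p).
  rewrite /= al /=; elim: (p) (a) pP => //= y q IH x /andP[/and3P[_ _ yl] /IH qP].
  by rewrite yl.
have /G_acyclic : ucycle (@adj G) (w :: a :: p).
  apply/andP; split; last first.
    by rewrite cons_uniq p_uniq andbT; apply: contra wl => /(allP p_l).
  rewrite /= wa rcons_path -pb adj_sym wb andbT.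
  by apply: sub_path pP => x y /and3P[].
by case: (p) pb => // ba; rewrite ba eqxx in ab.
Qed.

(** A neighbour of the last vertex is preferred; failing that, connectedness provides some other
    edge leaving [l]. *)
Lemma dfs_extend x0 l : dfs_list x0 l -> size l < #|G| ->
  exists w, dfs_list x0 (rcons l w).
Proof.
move=> lD lG; have [l_uniq l0 lx0 lP] := lD.
have x0l : x0 \in l by rewrite -lx0 mem_nth.
have ext j w : j < size l -> w \notin l -> adj w (nth x0 l j) ->
    (j != (size l).-1 -> forall w, w \notin l -> ~~ adj (nth x0 l (size l).-1) w) ->
    dfs_list x0 (rcons l w).
  move=> jl wl wj jmax; split.
  - by rewrite rcons_uniq wl.
  - by rewrite size_rcons.
  - by rewrite nth_rcons l0.
  - move=> i; rewrite size_rcons ltnS => /andP[i0].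
    rewrite leq_eqVlt => /predU1P[->|il].
      exists j => //; split=> [k kl|].
        rewrite !nth_rcons ltnn eqxx kl; apply/idP/eqP => [wk|->//].
        apply/eqP; rewrite -(nth_uniq x0 kl jl l_uniq); apply/eqP.
        by apply: dfs_unique_neighbour lD wl _ _ wk wj; exact: mem_nth.
      by rewrite -cats1 take_size_cat // nth_cat ltn_predL l0.
    have [|k ki [H1 H2]] := lP i; first by rewrite i0.
    exists k => //; split=> [m mi|/H2 {}H2 v].
      by rewrite !nth_rcons il (ltn_trans mi il) H1.
    rewrite -cats1 take_cat il => /H2.
    by rewrite nth_cat (leq_ltn_trans (leq_pred i) il).
case: (pickP [pred w | (w \notin l) && adj (nth x0 l (size l).-1) w]) => [w /andP[wl lw]|no_last].
  by exists w; apply: (ext (size l).-1); rewrite ?ltn_predL // 1?adj_sym // eqxx.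
have [[w v] /= /and3P[wl vl wv]|no_edge] :=
    pickP [pred u : G * G | [&& u.1 \notin l, u.2 \in l & adj u.1 u.2]].
  exists w; apply: (ext (index v l)); rewrite ?index_mem ?nth_index // => _ u ul.
  by have := no_last u; rewrite /= ul => /negbT.
have l_closed : closed (@adj G) [in l].
  apply: intro_closed => [|x y xy xl].
    by apply: sym_connect_sym; exact: adj_sym.
  by have := no_edge (y, x); rewrite /= adj_sym xy xl !andbT => /negbFE.
have : l =i predT.
  move=> y; rewrite -(closed_connect l_closed (proj2 G_conn x0 y)).
  by rewrite inE x0l.
move/card_uniqP: l_uniq lG => <- lG /eq_card lE.
by rewrite lE ltnn in lG.
Qed.

Lemma dfs_exists x0 : exists2 l, dfs_list x0 l & size l = #|G|.
Proof.
suff grow m : m <= #|G| -> 0 < m -> exists2 l, dfs_list x0 l & size l = m.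
  by apply: grow => //; have [] := G_conn.
elim: m => // -[_ _ _|m IH mG _].
  by exists [:: x0] => //; split => // i; rewrite /= ltnS; case: i.
have [l lD lm] := IH (ltnW mG) isT.
have [|w wD] := dfs_extend lD; first by rewrite lm.
by exists (rcons l w); rewrite ?size_rcons ?lm.
Qed.

(* In a greedy depth-first order a vertex that is not attached to its
   predecessor is only visited when that predecessor is a dead end. *)
Definition dfs_order (N : nat -> G) (par : nat -> nat) : Prop :=
  [/\ forall i j, i < #|G| -> j < #|G| -> N i = N j -> i = j,
      forall v, exists2 i, i < #|G| & N i = v,
      forall i, 0 < i < #|G| -> par i < i,
      forall i k, k < i < #|G| -> adj (N i) (N k) = (k == par i) &
      forall i k, 0 < i -> i <= k < #|G| -> par i != i.-1 -> ~~ adj (N i.-1) (N k)].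

Lemma dfs_order_exists x0 : exists N par, N 0 = x0 /\ dfs_order N par.
Proof.
have [l [l_uniq l0 lx0 lP] lG] := dfs_exists x0.
pose N := nth x0 l.
exists N, (fun i => find (adj (N i)) l); split=> //.
have parE i : 0 < i < size l -> exists2 j, j < i &
    [/\ find (adj (N i)) l = j, forall k, k < i -> adj (N i) (N k) = (k == j)
      & j != i.-1 -> forall w, w \notin take i l -> ~~ adj (N i.-1) w].
  move=> il; have [j ji [H1 H2]] := lP i il; exists j => //; split=> //.
  have jl : j < size l by lia.
  have has_l : has (adj (N i)) l.
    by apply/hasP; exists (N j); rewrite ?mem_nth // H1.
  have := nth_find x0 has_l; rewrite -/(N _).
  have [|ij] := ltnP (find (adj (N i)) l) i; first by move/H1 => -> /eqP.
  by have := before_find x0 (leq_trans ji ij); rewrite -/(N _) H1 ?eqxx.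
rewrite /dfs_order -lG; split.
- by move=> i j il jl /eqP; rewrite nth_uniq // => /eqP.
- move=> v; have vl : v \in l.
    have : l =i predT by apply/subset_cardP; [rewrite (card_uniqP l_uniq)|exact: subset_predT].
    by move->.
  by exists (index v l); rewrite ?index_mem // /N nth_index.
- by move=> i /parE[j ji [-> _ _]].
- move=> i k /andP[ki il]; have [|j ji [-> -> //]] := parE i.
  by rewrite il andbT; apply: leq_ltn_trans ki.
- move=> i k i0 /andP[ik kl]; have [|j ji [-> _ H]] := parE i.
    by rewrite i0 (leq_ltn_trans ik).
  move/H; apply; apply/negP => /(nthP x0)[m]; rewrite size_take.
  move=> mi; rewrite nth_take; last by move: mi; case: ifP; lia.
  move/eqP; rewrite nth_uniq //; last by move: mi; case: ifP; lia.
  by move: mi; case: ifP; lia.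
Qed.

Section Order.
Variables (N : nat -> G) (par : nat -> nat).
Hypothesis NP : dfs_order N par.
Let n := #|G|.
Let N_inj : forall i j, i < n -> j < n -> N i = N j -> i = j. Proof. by case: NP. Qed.
Let N_surj : forall v, exists2 i, i < n & N i = v. Proof. by case: NP. Qed.
Let par_lt : forall i, 0 < i < n -> par i < i. Proof. by case: NP. Qed.
Let adjN : forall i k, k < i < n -> adj (N i) (N k) = (k == par i). Proof. by case: NP. Qed.
Let dead_end : forall i k, 0 < i -> i <= k < n -> par i != i.-1 -> ~~ adj (N i.-1) (N k).
Proof. by case: NP. Qed.

Lemma last_leaf u v : 1 < n -> adj (N n.-1) u -> adj (N n.-1) v -> u = v.
Proof.
have E w : 1 < n -> adj (N n.-1) w -> w = N (par n.-1).
  move=> n1; have [i il <-] := N_surj w.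
  have [->|iN] := eqVneq i n.-1; first by rewrite adj_irr.
  by rewrite adjN; [move/eqP-> | lia].
by move=> n1 /(E _ n1)-> /(E _ n1)->.
Qed.

Lemma card_le_degree v (s : seq nat) : v < n -> uniq s ->
  all (fun k => (k < n) && adj (N v) (N k)) s -> size s <= degree (N v).
Proof.
move=> vn s_uniq /allP sP; rewrite /degree.
have NS_uniq : uniq (map N s).
  by rewrite map_inj_in_uniq // => i j /sP/andP[? _] /sP/andP[? _]; exact: N_inj.
rewrite -(size_map N) -(card_uniqP NS_uniq); apply/subset_leq_card/subsetP => w.
by move=> /mapP[k /sP/andP[_ kv] ->]; rewrite inE.
Qed.

Hypothesis leaf0 : forall u v, adj (N 0) u -> adj (N 0) v -> u = v.
Hypothesis deg3 : forall v : G, degree v <= 3.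

Let adj_par i : 0 < i < n -> adj (N i) (N (par i)).
Proof. by move=> i0; rewrite adjN ?eqxx // par_lt //; case/andP: i0. Qed.

Definition jump i := (0 < i < n) && (par i != i.-1).

(** The search returns to [par i], so this vertex was not a dead end and its successor is its child;
    the root being a leaf, it also has a parent. With [i] these are three neighbours. *)
Lemma jump_parent i : jump i -> [/\ 0 < par i, (par i).+1 < i, par (par i).+1 = par i
   & degree (N (par i)) = 3].
Proof.
move=> /andP[i0 ji]; have pi := par_lt i0.
have iq := adj_par i0; rewrite adj_sym in iq.
have q1 : (par i).+1 < i by lia.
have pq : par (par i).+1 = par i.
  apply/eqP; apply: contraTT iq => pq; apply: (@dead_end (par i).+1) => //.
  by lia.
have adj_q1 : adj (N (par i)) (N (par i).+1).
  by rewrite adj_sym -{2}pq adj_par //; lia.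
have q0 : 0 < par i.
  rewrite lt0n; apply/eqP => q0; rewrite q0 in iq adj_q1.
  by have /N_inj := leaf0 iq adj_q1; move: q1; rewrite q0; lia.
have adj_pq := adj_par (i := par i); have ppq := par_lt (i := par i).
split=> //; apply/eqP; rewrite eqn_leq deg3.
apply: (@card_le_degree _ [:: par (par i); (par i).+1; i]) => /=; first by lia.
  by rewrite !inE; lia.
rewrite iq adj_q1 adj_pq; lia.
Qed.

Lemma jump_parent_inj i j : jump i -> jump j -> par i = par j -> i = j.
Proof.
move=> ij jj pij; apply/eqP; apply/negP => /negP ne.
have [q0 q1 pq _] := jump_parent ij; have [_ q1' _ _] := jump_parent jj.
have := deg3 (N (par i)); apply/negP; rewrite -ltnNge.
have /andP[i0 _] := ij; have /andP[j0 _] := jj.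
have a1 := adj_par i0; have a2 := adj_par j0.
have a3 : adj (N (par i).+1) (N (par i)) by rewrite -{2}pq adj_par //; lia.
have a4 : adj (N (par i)) (N (par (par i))) by rewrite adj_par //; lia.
have pp := par_lt (i := par i).
apply: (@card_le_degree _ [:: par (par i); (par i).+1; i; j]) => /=; first by lia.
  by rewrite !inE; lia.
by rewrite ![adj (N (par i)) _]adj_sym a1 a3 pij a2 -pij adj_sym a4; lia.
Qed.

Lemma branch_jump v : degree v = 3 -> exists2 i, jump i & N (par i) = v.
Proof.
move=> dv; have [u un uv] := N_surj v.
case: (pickP [pred i : 'I_n | jump i && (par i == u)]) => [i /andP[ji /eqP iu]|no_jump].
  by exists i; rewrite ?iu.
suff : degree v <= 2 by rewrite dv.
have sub : [set w | adj v w] \subset [set N (par u); N u.+1].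
  apply/subsetP => w; rewrite !inE; have [k kn <-] := N_surj w; rewrite -uv => uk.
  have [ku|ku|ku] := ltngtP k u.
  - by rewrite adjN ?ku // in uk; rewrite (eqP uk) eqxx.
  - have pk : par k = u by apply/esym/eqP; rewrite -adjN ?ku // adj_sym.
    have := no_jump (Ordinal kn); rewrite /= pk eqxx andbT /jump pk.
    by rewrite (leq_ltn_trans _ ku) // kn /= => /negbFE/eqP ->; rewrite prednK ?eqxx ?orbT //; lia.
  - by rewrite ku adj_irr in uk.
by rewrite /degree (leq_trans (subset_leq_card sub)) // cards2; case: eqP.
Qed.

(** Jumps correspond to branch vertices: a parent shared by two jumps would have degree 4, and a
    vertex that no jump returns to has at most its parent and its successor as neighbours. *)
Lemma two_jumps : #|[set v : G | degree v == 3]| = 2 ->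
  exists p q r s, [/\ 0 < q, q.+1 < p, p < r < n, 0 < s & s.+1 < r] /\
    [/\ s != p.-1, q != s & forall i j : 'I_n, adj (N i) (N j) = jump_adj p q r s i j].
Proof.
move=> /eqP /cards2P[u [v [uv uvE]]].
have [|pu ju Nu] := @branch_jump u; first by apply/eqP; have := set21 u v; rewrite -uvE inE.
have [|pv jv Nv] := @branch_jump v; first by apply/eqP; have := set22 u v; rewrite -uvE inE.
have par_uv : par pu != par pv by apply: contra uv => /eqP; rewrite -Nu -Nv => ->.
have only i : jump i -> (i == pu) || (i == pv).
  move=> ji; have [_ q1 _ d3] := jump_parent ji; have /andP[iN _] := ji.
  have : N (par i) \in [set u; v] by rewrite -uvE inE d3.
  have [_ ? _ _] := jump_parent ju; have [_ ? _ _] := jump_parent jv.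
  have /andP[? _] := ju; have /andP[? _] := jv.
  rewrite !inE -Nu -Nv => /orP[] /eqP /N_inj E; apply/orP; [left|right]; apply/eqP.
    by apply: jump_parent_inj => //; apply: E; lia.
  by apply: jump_parent_inj => //; apply: E; lia.
wlog puv : u v uv uvE pu ju Nu pv jv Nv par_uv only / pu < pv => [hw|].
  have [puv|pvu|puv] := ltngtP pu pv; first exact: (hw u v uv uvE pu ju Nu pv).
    apply: (hw v u _ _ pv jv Nv pu) => //; try by rewrite eq_sym.
      by rewrite uvE setUC.
    by move=> i /only; rewrite orbC.
  by rewrite puv eqxx in par_uv.
have [qu0 qu1 pqu _] := jump_parent ju; have [qv0 qv1 pqv _] := jump_parent jv.
have /andP[puN ju'] := ju; have /andP[pvN jv'] := jv.
exists pu, (par pu), pv, (par pv); split; first by split; lia.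
split=> //.
  (* The vertex before a jump is a dead end, so no later vertex hangs from it. *)
  apply/eqP => sp; have := dead_end (i := pu) (k := pv) _ _ ju'.
  by rewrite -sp adj_sym adj_par // (ltnW puv); lia.
have parE i : 0 < i < n ->
    par i = if i == pu then par pu else if i == pv then par pv else i.-1.
  move=> i0; case: eqP => [->//|/eqP iu]; case: eqP => [->//|/eqP iv].
  apply/eqP; have := contraNN (only i); rewrite (negPf iu) (negPf iv) => /(_ isT).
  by rewrite /jump i0 negbK.
have adj_lt i j : j < i < n -> adj (N i) (N j) = jump_adj pu (par pu) pv (par pv) i j.
  by move=> ji; rewrite adjN // parE ?jump_adj_lt //; lia.
move=> i j; have [ij|ji|ij] := ltngtP i j.
- by rewrite adj_sym jump_adj_sym adj_lt // ij ltn_ord.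
- by rewrite adj_lt // ji ltn_ord.
- by rewrite ij adj_irr; apply/esym/negbTE/jump_adj_irr; lia.
Qed.

End Order.

Lemma jump_labelled : (forall v : G, degree v <= 3) ->
  #|[set v : G | degree v == 3]| = 2 ->
  exists p q r s, [/\ 0 < q, q.+1 < p, p < r < #|G|, 0 < s & s.+1 < r] /\
    [/\ s != p.-1, q != s & labelled #|G| (jump_adj p q r s) G].
Proof.
move=> deg3 two.
have [x1 _] : exists x1 : G, degree x1 = 3.
  have [x] : exists x, x \in [set v : G | degree v == 3] by apply/card_gt0P; rewrite two.
  by rewrite inE => /eqP; exists x.
have [N1 [par1 [_ D1]]] := dfs_order_exists x1.
have G1 : 1 < #|G| by rewrite -two max_card.
(* The last vertex of the first search is a leaf; starting again there keeps the root from being a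
   branch vertex. *)
have [N [par [N0 D]]] := dfs_order_exists (N1 #|G|.-1).
have leaf0 u v : adj (N 0) u -> adj (N 0) v -> u = v.
  by rewrite N0; exact: (last_leaf D1 G1).
have [p [q [r [s [? [sp qs E]]]]]] := two_jumps D leaf0 deg3 two.
exists p, q, r, s; split=> //; split=> //; exists (fun i : 'I_#|G| => N i); split=> //.
have [N_inj _ _ _ _] := D.
apply: inj_card_bij; last by rewrite card_ord.
by move=> i j /N_inj ij; apply/val_inj/ij.
Qed.

End DepthFirst.

Lemma jump_arcE p q r s i j : 0 < p -> p < r ->
  jump_arc p q r s i j =
  (0 < i) && (j == if i == p then q else if i == r then s else i.-1).
Proof.
move=> p0 pr; rewrite /jump_arc.
have [->|ip] := eqVneq i p; first by rewrite p0 (ltn_eqF pr) /= ?andbF ?orbF.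
have [->|ir] := eqVneq i r; first by rewrite (ltn_trans p0 pr) /= ?andbF ?orbF.
by [].
Qed.

Lemma jump_relabel n p q r s p' q' r' s' (f : nat -> nat) (G : sgraph) :
  let par i := if i == p then q else if i == r then s else i.-1 in
  let par' i := if i == p' then q' else if i == r' then s' else i.-1 in
  0 < p < r -> 0 < p' < r' ->
  (forall i, i < n -> f i < n) ->
  (forall i j, i < n -> j < n -> f i = f j -> i = j) ->
  (forall i, i < n -> par i < n) ->
  f 0 = 0 ->
  (forall i, 0 < i < n -> par' (f i) = f (par i)) ->
  labelled n (jump_adj p q r s) G -> labelled n (jump_adj p' q' r' s') G.
Proof.
move=> par par' /andP[p0 pr] /andP[p0' pr'] fn f_inj par_n f0 fpar.
apply: (@labelled_relabel _ _ _ _ f) => //.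
have arc i j : i < n -> j < n -> jump_arc p' q' r' s' (f i) (f j) = jump_arc p q r s i j.
  move=> il jl; rewrite !jump_arcE // -/(par' (f i)) -/(par i).
  have [->|i0] := posnP i; first by rewrite f0.
  have -> : 0 < f i by rewrite lt0n; apply/eqP; rewrite -f0 => /f_inj fi; lia.
  rewrite fpar ?i0 //=; apply/eqP/eqP => [/f_inj|->//]; apply=> //; exact: par_n.
by move=> i j il jl; rewrite /jump_adj !arc.
Qed.

(** For [q < s < p] the labels already have the shape of [lab_adj]. For [p <= s] a leg at [q] was
    visited before the middle path, and for [s < q] the extra leg at [q] came before the one at [s];
    there [f] moves blocks of consecutive labels. *)
Lemma tree_labelled (G : sgraph) n : two_max_degree_tree n 3 G ->
  exists a b d c e, [/\ [/\ 0 < a, 0 < b, 0 < d, 0 < c & 0 < e],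
    (a + b + d + c + e).+1 = n & labelled n (lab_adj a b d c) G].
Proof.
case=> Gn [Gc Ga] deg3 two; rewrite deg3 in two.
have le3 (v : G) : degree v <= 3 by rewrite -deg3; exact: leq_bigmax.
have [p [q [r [s [[q0 qp /andP[pr rn] s0 sr] [sp qs L]]]]]] := jump_labelled Gc Ga le3 two.
rewrite Gn in rn L; clear Gc Ga deg3 two le3 Gn.
have [ps|sp'] := leqP p s.
- pose f i := if i <= q then i else if i < p then i + (r - p)
    else if i < r then i - (p - q.+1) else i.
  exists q, (p.-1 - q), (s - p).+1, (r.-1 - s), (n - r); split; first by split; lia.
    by lia.
  apply: (jump_relabel (f := f)) L => [|||i j||//|i i0].
  + by lia.
  + by lia.
  + by move=> i; rewrite /f; do ![case: ifPn => ?]; lia.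
  + by rewrite /f; do ![case: ifPn => ?]; lia.
  + by move=> i; do ![case: ifPn => ?]; lia.
  + have f1 k : k <= q -> f k = k by rewrite /f => ->.
    have f2 k : q < k < p -> f k = k + (r - p) by move=> ?; rewrite /f ifF ?ifT //; lia.
    have f3 k : p <= k < r -> f k = k - (p - q.+1).
      by move=> ?; rewrite /f ifF 1?ifF ?ifT //; lia.
    have f4 k : r <= k -> f k = k by move=> ?; rewrite /f !ifF //; lia.
    have [->|ip] := eqVneq i p.
      by rewrite /= f3 ?f1 ?ifF ?ifF //; lia.
    have [->|ir] := eqVneq i r.
      by rewrite /= f4 ?f3 1?ifF ?ifT //; lia.
    have [iq|qi] := leqP i q; first by rewrite /= !f1 ?ifF ?ifF //; lia.
    have [pi|pi] := ltnP i p.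
      have [->|iq] := eqVneq i q.+1; first by rewrite /= f2 ?f1 ?ifT //; lia.
      by rewrite /= !f2 ?ifF ?ifF //; lia.
    have [ri|ri] := ltnP i r; first by rewrite /= !f3 ?ifF ?ifF //; lia.
    by rewrite /= !f4 ?ifF ?ifF //; lia.
- have [qs'|sq|] := ltngtP q s; last by move/eqP; rewrite (negPf qs).
  + exists q, (r - p), (s - q), (p.-1 - s), (n - r); split; first by split; lia.
      by lia.
    rewrite /lab_adj (_ : (q + (s - q) + (p.-1 - s)).+1 = p); last by lia.
    by rewrite (_ : p + (r - p) = r) 1?(_ : q + (s - q) = s) //; lia.
  + pose f i := if i < p then i else if i < r then i + (n - r) else i - (r - p).
    exists s, (n - r), (q - s), (p.-1 - q), (r - p); split; first by split; lia.
      by lia.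
    apply: (jump_relabel (f := f)) L => [|||i j|||i i0].
    * by lia.
    * by lia.
    * by move=> i; rewrite /f; do ![case: ifPn => ?]; lia.
    * by rewrite /f; do ![case: ifPn => ?]; lia.
    * by move=> i; do ![case: ifPn => ?]; lia.
    * by rewrite /f ifT //; lia.
    * have f1 k : k < p -> f k = k by rewrite /f => ->.
      have f2 k : p <= k < r -> f k = k + (n - r).
        by move=> ?; rewrite /f ifF ?ifT //; lia.
      have f3 k : r <= k -> f k = k - (r - p) by move=> ?; rewrite /f !ifF //; lia.
      have [->|ip] := eqVneq i p.
        by rewrite /= f2 ?f1 1?ifF ?ifT //; lia.
      have [->|ir] := eqVneq i r.
        by rewrite /= f3 ?f1 ?ifT //; lia.
      have [pi|pi] := ltnP i p; first by rewrite /= !f1 ?ifF ?ifF //; lia.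
      have [ri|ri] := ltnP i r; first by rewrite /= !f2 ?ifF ?ifF //; lia.
      by rewrite /= !f3 ?ifF ?ifF //; lia.
Qed.

Lemma labelled_nat n E (G : sgraph) : 0 < n -> labelled n E G ->
  exists N : nat -> G,
  [/\ forall i j, i < n -> j < n -> N i = N j -> i = j,
      forall v, exists2 i, i < n & N i = v &
      forall i j, i < n -> j < n -> adj (N i) (N j) = E i j].
Proof.
move=> n0 [h [[h' hK h'K] hE]].
pose o i := insubd (Ordinal n0) i.
have oE i : i < n -> val (o i) = i by move=> il; rewrite val_insubd il.
exists (fun i => h (o i)); split=> [i j il jl /(can_inj hK) E1|v|i j il jl].
- by rewrite -(oE i) // -(oE j) // E1.
- exists (h' v) => //; rewrite (_ : o (h' v) = h' v) ?h'K //.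
  by apply/val_inj; rewrite oE.
- by rewrite hE !oE.
Qed.

(** * The converse: structure and 2-branches of a labelled graph *)

Section LabelledTree.
Variables (G : sgraph) (n p q r s : nat) (N : nat -> G).
Hypotheses (q0 : 0 < q) (qp : q.+1 < p) (pr : p < r) (rn : r < n)
  (s0 : 0 < s) (sr : s.+1 < r) (sp : s != p.-1) (qs : q != s).
Hypotheses (N_inj : forall i j, i < n -> j < n -> N i = N j -> i = j)
  (N_surj : forall v, exists2 i, i < n & N i = v)
  (N_adj : forall i j, i < n -> j < n -> adj (N i) (N j) = jump_adj p q r s i j).

Let par i := if i == p then q else if i == r then s else i.-1.

Let par_lt i : 0 < i -> par i < i.
Proof. by rewrite /par; case: eqP => [->|_]; [|case: eqP => [->|_]]; lia. Qed.

Let adj_lt i j : j < i < n -> adj (N i) (N j) = (j == par i).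
Proof. by move=> /andP[ji il]; rewrite N_adj ?jump_adj_lt //; lia. Qed.

Lemma labelled_connected : connected_graph G.
Proof.
split; first by apply/card_gt0P; exists (N 0).
have root i : i < n -> connect (@adj G) (N 0) (N i).
  elim/ltn_ind: i => i IH il; have [->//|i0] := posnP i.
  have pi := par_lt i0.
  apply: connect_trans (IH _ pi (ltn_trans pi il)) (connect1 _).
  by rewrite adj_sym adj_lt ?eqxx // pi.
move=> x y; have [i il <-] := N_surj x; have [j jl <-] := N_surj y.
apply: connect_trans (root j jl).
by rewrite sym_connect_sym; [exact: root|exact: adj_sym].
Qed.

(* The two neighbours, along a cycle, of the vertex with largest label would
   both be its parent. *)
Lemma labelled_acyclic : acyclic_graph G.
Proof.
move=> c cP; rewrite ltnNge; apply/negP => c3.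
have [x0 x0c] : exists x, x \in c by case: c c3 {cP} => // x ? _; exists x; rewrite mem_head.
pose lab v := if [pick i : 'I_n | N i == v] is Some i then val i else 0.
have labE i : i < n -> lab (N i) = i.
  move=> il; rewrite /lab; case: pickP => [j /eqP Nj|/(_ (Ordinal il))].
    exact: N_inj Nj.
  by rewrite eqxx.
case: (@arg_maxnP _ x0 [in c] lab x0c) => x xc x_max.
have [k c' c_rot] := rot_to xc.
move: cP; rewrite -(rot_ucycle k) c_rot.
have := size_rot k c; rewrite c_rot /= => c_size.
case: c' c_rot c_size => [|y [|z c']] c_rot /= c_size; try lia.
move=> /andP[/= /andP[xy]]; rewrite rcons_path => /andP[_ /andP[_ lx]] /and3P[xn yn _].
have in_c w : w \in [:: x, y, z & c'] -> w \in c by rewrite -c_rot mem_rot.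
have [i il iE] := N_surj x.
have parent w : w \in [:: x, y, z & c'] -> adj x w -> w = N (par i).
  move=> /in_c/x_max; have [j jl <-] := N_surj w; rewrite -iE !labE // => ji xw.
  have ij : j != i by apply: contraTneq xw => ->; rewrite adj_irr.
  by move: xw; rewrite adj_lt => [/eqP->//|]; lia.
have lz : last z c' \in z :: c' by exact: mem_last.
have yE : y = N (par i) by apply: parent; rewrite // !inE eqxx orbT.
have : last z c' = N (par i).
  by apply: parent; [rewrite in_cons in_cons lz !orbT|rewrite adj_sym].
by move=> lE; rewrite yE -lE lz in yn.
Qed.

Lemma labelled_degree i : i < n -> degree (N i)
  = (0 < i) + [&& i.+1 != p, i.+1 != r & i.+1 < n] + (i == q) + (i == s).
Proof.
move=> il.
pose child := [&& i.+1 != p, i.+1 != r & i.+1 < n].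
(* Parent, successor and attached legs in increasing order, so that sortedness gives [uniq l]. *)
pose l := nseq (0 < i) (par i) ++ nseq child i.+1 ++ nseq (i == q) p ++ nseq (i == s) r.
have lE j : (j \in l) = [|| (0 < i) && (j == par i), child && (j == i.+1),
    (i == q) && (j == p) | (i == s) && (j == r)].
  have b0 (b : bool) : (0 < b) = b by case: b.
  by rewrite !mem_cat !mem_nseq !b0.
have l_n j : j \in l -> j < n.
  rewrite lE => /or4P[] /andP[+ /eqP->] //.
  - by move=> /par_lt pi; exact: ltn_trans il.
  - by case/and3P.
  - by rewrite (ltn_trans pr).
have l_uniq : uniq l.
  apply: (sorted_uniq ltn_trans ltnn); rewrite /l {lE l_n l}.
  move: (child) => child1; have [iq|_] := eqVneq i q.
    rewrite iq (negPf qs) q0; have pq := par_lt q0.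
    by case: child1; rewrite /= ?qp ?(leqW pq) ?(ltn_trans pq (ltnW qp)).
  have [->|_] := eqVneq i s.
    rewrite s0; have ps := par_lt s0.
    by case: child1; rewrite /= ?sr ?(leqW ps) ?(ltn_trans ps (ltnW sr)).
  have [_|/par_lt pi] := posnP i; first by case: child1.
  by case: child1; rewrite //= leqW.
have -> : degree (N i) = size l; last first.
  by rewrite /l !size_cat !size_nseq !addnA.
rewrite -(size_map N); have Nl_uniq : uniq (map N l).
  by rewrite map_inj_in_uniq // => j k /l_n jn /l_n kn; exact: N_inj.
rewrite -(card_uniqP Nl_uniq) /degree; apply: eq_card => w; rewrite inE.
have [j jl <-] := N_surj w; rewrite N_adj //.
have -> : (N j \in [seq N k | k <- l]) = (j \in l).
  apply/mapP/idP => [[k kl /N_inj ->//]|jl']; last by exists j.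
  exact: l_n.
rewrite lE /jump_adj jump_arcE // -/(par i); last by rewrite (leq_ltn_trans _ qp).
congr (_ || _); rewrite /jump_arc orbA orbC [(j == p) && _]andbC [(j == r) && _]andbC.
congr (_ || _); rewrite /child; case: j jl => [|j] jl; first by rewrite andbF.
rewrite /= eqSS [i == j]eq_sym; have [ij|_] := eqVneq j i; last by rewrite !andbF.
by rewrite -ij jl !andbT.
Qed.

Let branch_child i : (i == q) || (i == s) ->
  (0 < i) && [&& i.+1 != p, i.+1 != r & i.+1 < n].
Proof.
case/orP => /eqP->; first by rewrite q0 /=; apply/and3P; split; lia.
by rewrite s0 /=; apply/and3P; split; lia.
Qed.

Let degree3 i : i < n -> (degree (N i) == 3) = (i == q) || (i == s).
Proof.
move=> il; rewrite labelled_degree //; have := @branch_child i.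
have [->|_] := eqVneq i q; first by rewrite (negPf qs) => /(_ isT)/andP[-> ->].
by case: eqP => _ => [/(_ isT)/andP[-> ->]|_]; last by case: (0 < i); case: [&& _, _ & _].
Qed.

Let le_degree3 (v : G) : degree v <= 3.
Proof.
have [i il <-] := N_surj v; have := degree3 il; rewrite labelled_degree //.
have [->|_] := eqVneq i q; first by rewrite (negPf qs) /= => /eqP->.
case: (i =P s) => _ /= => [/eqP->//|_].
by case: (0 < i); case: [&& _, _ & _].
Qed.

Lemma labelled_two_max : #|G| = n -> two_max_degree_tree n 3 G.
Proof.
move=> Gn.
have maxG : max_degree G = 3.
  apply/eqP; rewrite eqn_leq; apply/andP; split; first by apply/bigmax_leqP.
  have /eqP <- : degree (N q) == 3 by rewrite degree3 ?eqxx //; lia.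
  exact: leq_bigmax.
split=> //; first by split; [exact: labelled_connected|exact: labelled_acyclic].
rewrite maxG (_ : [set v | _] = [set N q; N s]).
  by rewrite cards2 (_ : N q != N s) //; apply: contra qs => /eqP/N_inj->//; lia.
apply/setP => v; have [i il <-] := N_surj v; rewrite !inE degree3 //.
by congr (_ || _); apply/eqP/eqP => [->//|/N_inj]; apply; lia.
Qed.

(** A 2-branch is a leaf, and only the far ends of the four legs can be leaves. *)
Lemma labelled_num_2branches_le : num_2branches G <= 4.
Proof.
have sub : {subset [set v : G | (degree v == 1) && [exists u : G, adj v u && (degree u == 2)]]
    <= map N [:: 0; p.-1; r.-1; n.-1]}.
  move=> v; rewrite inE => /andP[+ _]; have [i il <-] := N_surj v.
  rewrite labelled_degree // => di; apply/mapP; exists i => //.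
  apply: contraLR di; rewrite !inE !negb_or => /and4P[i0 ip ir iN].
  have -> : i.+1 != p by apply: contraNneq ip => <-.
  have -> : i.+1 != r by apply: contraNneq ir => <-.
  have -> : i.+1 < n by rewrite ltn_neqAle il andbT; apply: contraNneq iN => <-.
  by rewrite lt0n i0.
apply: leq_trans (card_size (map N [:: 0; p.-1; r.-1; n.-1])).
by apply: subset_leq_card; apply/subsetP.
Qed.

Hypotheses (leg0 : q = 2) (leg1 : s.+3 = p) (leg2 : p.+2 = r) (leg3 : r.+2 = n)
  (branches_apart : q.+1 < s).

Lemma labelled_num_2branches_ge : 4 <= num_2branches G.
Proof.
have two_branch i j : i < n -> j < n -> degree (N i) == 1 -> degree (N j) == 2 ->
    0 < i /\ j = par i \/ 0 < j /\ i = par j ->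
    N i \in [set v : G | (degree v == 1) && [exists u : G, adj v u && (degree u == 2)]].
  move=> il jl di dj pij; rewrite inE di; apply/existsP; exists (N j); rewrite dj andbT.
  case: pij => -[i0 E]; first by rewrite adj_lt E ?eqxx // par_lt.
  by rewrite adj_sym adj_lt E ?eqxx // par_lt.
have N4 : uniq (map N [:: 0; p.-1; r.-1; n.-1]).
  rewrite map_inj_in_uniq; first by rewrite /= !inE; lia.
  by move=> i j; rewrite !inE => ? ? /N_inj; apply; lia.
rewrite -[4]/(size (map N [:: 0; p.-1; r.-1; n.-1])) -(card_uniqP N4).
apply: subset_leq_card; apply/subsetP => v.
have pE i : i != p -> i != r -> par i = i.-1.
  by rewrite /par => /negPf-> /negPf->.
move=> /mapP[i i4 ->]; move: i4; rewrite !in_cons => /or4P[/eqP->|/eqP->|/eqP->|].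
- apply: (two_branch _ 1); rewrite ?labelled_degree ?pE //; lia.
- apply: (two_branch _ p.-2); rewrite ?labelled_degree ?pE //; lia.
- apply: (two_branch _ p); rewrite ?labelled_degree ?[par r.-1]pE //; lia.
- rewrite orbF => /eqP->; apply: (two_branch _ r); rewrite ?labelled_degree ?[par n.-1]pE //; lia.
Qed.

End LabelledTree.

Section LabelledGraph.
Variables (G : sgraph) (n a b d c e : nat).
Hypotheses (a0 : 0 < a) (b0 : 0 < b) (d0 : 0 < d) (c0 : 0 < c) (e0 : 0 < e)
  (nE : (a + b + d + c + e).+1 = n) (GL : labelled n (lab_adj a b d c) G).

Let n0 : 0 < n. Proof. by rewrite -nE. Qed.

Lemma lab_two_max : two_max_degree_tree n 3 G.
Proof.
have [N [N_inj N_surj N_adj]] := labelled_nat n0 GL.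
apply: (labelled_two_max _ _ _ _ _ _ _ _ N_inj N_surj N_adj); try lia.
by have [h [hb _]] := GL; rewrite -(bij_eq_card hb) card_ord.
Qed.

Lemma lab_num_2branches_le : num_2branches G <= 4.
Proof.
have [N [N_inj N_surj N_adj]] := labelled_nat n0 GL.
by apply: (labelled_num_2branches_le _ _ _ _ _ _ _ _ N_inj N_surj N_adj); lia.
Qed.

Lemma lab_num_2branches_ge : [/\ a = 2, b = 2, c = 2 & e = 2] -> 1 < d ->
  4 <= num_2branches G.
Proof.
move=> [a2 b2 c2 e2] d1; have [N [N_inj N_surj N_adj]] := labelled_nat n0 GL.
by apply: (labelled_num_2branches_ge _ _ _ _ _ _ _ _ N_inj N_surj N_adj); lia.
Qed.

End LabelledGraph.

(** Matches [lab_adj 2 2 u 2], where [t = u.+1] because the ends of [P_t] are at distance [t - 1].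
    The paths with [k = 0] extend [P_t] to the spine; those with [k = 1] are the two remaining
    legs. *)
Definition Ta_label (u : nat) (x : Ta_vertex 3 u.+1) : nat :=
  match x with
  | inl i => i.+2
  | inr (side, k, far) =>
    match side, nat_of_ord k, far with
    | false, 0, false => 1
    | false, 0, true => 0
    | true, 0, false => u.+3
    | true, 0, true => u.+4
    | false, _, false => u.+4.+1
    | false, _, true => u.+4.+2
    | true, _, false => u.+4.+3
    | true, _, true => u.+4.+4
    end
  end.

Lemma Ta_label_lt u (x : Ta_vertex 3 u.+1) : Ta_label x < u.+4.+4.+1.
Proof.
case: x => [i|[[[] [[|[|//]] ki]] []]] /=; rewrite ?ltnS; try lia.
have := ltn_ord i; lia.
Qed.

Lemma Ta_label_inj u : injective (@Ta_label u).
Proof.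
move=> [i|[[[] [[|[|//]] ki]] []]] [j|[[[] [[|[|//]] kj]] []]] //= E;
 try (by exfalso; move: E; try have := ltn_ord i; try have := ltn_ord j; lia);
 try (by congr (inr (_, _, _)); apply/val_inj).
by congr inl; apply/val_inj; case: E.
Qed.

Lemma Ta_label_adj u (x y : Ta_vertex 3 u.+1) : 0 < u ->
  lab_adj 2 2 u 2 (Ta_label x) (Ta_label y) = Ta_adj x y.
Proof.
move=> u0; rewrite /lab_adj /jump_adj !jump_arcE; try lia.
rewrite !addn2 !add2n.
case: x => [i|[[[] [[|[|//]] ki]] []]]; case: y => [j|[[[] [[|[|//]] kj]] []]];
  rewrite /Ta_adj /Ta_arc /=;
  try (have := ltn_ord i; move: (nat_of_ord i) => {}i);
  try (have := ltn_ord j; move: (nat_of_ord j) => {}j); rewrite ?eqSS.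
all: repeat case: eqP; lia.
Qed.

Lemma T_a_labelled n : 10 < n -> labelled n (lab_adj 2 2 (n - 9) 2) (T_a 3 (n - 8)).
Proof.
move=> n11; have [u nE] : exists u, n = u.+4.+4.+1 by exists (n - 9); lia.
rewrite nE.
have -> : u.+4.+4.+1 - 8 = u.+1 by lia.
have -> : u.+4.+4.+1 - 9 = u by lia.
pose f (x : T_a 3 u.+1) := Ordinal (Ta_label_lt x).
have [g fK gK] : bijective f.
  apply: inj_card_bij => [x y [] /Ta_label_inj//|].
  by rewrite card_ord card_sum !card_prod !card_ord card_bool; lia.
exists g; split; first by exists f.
move=> i j; rewrite -[in RHS](gK i) -[in RHS](gK j) /= Ta_label_adj //.
by lia.
Qed.

(** * The maximal energy tree *)

Lemma tree_poly_gt0 (R : realFieldType) (y : R) a b d c e :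
  (0 < y)%R -> 0 < c -> 0 < e -> (0 < tree_poly y a b d c e)%R.
Proof.
move=> y0 c0 e0; have [u [v [u0 v0 ->]]] := tree_poly_right y0 c0 e0.
by rewrite /two_legs addr_gt0 ?mulr_gt0 ?fibp_gt0 ?linrec_gt0.
Qed.

Section Maximality.
Variables (R : realType) (n : nat).
Hypothesis n11 : 10 < n.

Lemma lab_has_modulus (G : sgraph) a b d c e :
  [/\ 0 < a, 0 < b, 0 < d, 0 < c & 0 < e] -> (a + b + d + c + e).+1 = n ->
  labelled n (lab_adj a b d c) G ->
  has_modulus (real_spectrum R G) (fun y => tree_poly y a b d c e).
Proof.
move=> [a0 b0 d0 c0 e0] <- [h [hb hE]].
by apply: has_modulus_tree hb b0 d0 hE _ => y y0; exact: tree_poly_gt0.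
Qed.

Let optimal (G : sgraph) := labelled n (lab_adj 2 2 (n - 9) 2) G.

Let opt_sum : (2 + 2 + (n - 9) + 2 + 2).+1 = n. Proof. by lia. Qed.

Lemma optimal_two_max G : optimal G -> two_max_degree_tree n 3 G.
Proof. by apply: lab_two_max opt_sum => //; lia. Qed.

Lemma optimal_has_modulus G : optimal G ->
  has_modulus (real_spectrum R G) (fun y => tree_poly y 2 2 (n - 9) 2 2).
Proof. by apply: lab_has_modulus => //; split=> //; lia. Qed.

(** The strictness of the first alternative is what makes the maximum unique. *)
Lemma two_max_energy G H : optimal G -> two_max_degree_tree n 3 H ->
  (energy R H < energy R G)%R \/ optimal H.
Proof.
move=> GO HT; have GM := optimal_has_modulus GO.
have [Gn _ _ _] := optimal_two_max GO; have [Hn _ _ _] := HT.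
have eq_size : size (real_spectrum R G) = size (real_spectrum R H).
  by rewrite !size_real_spectrum Gn Hn.
have [a [b [d [c [e [pos sum HL]]]]]] := tree_labelled HT.
have HM := lab_has_modulus pos sum HL; have [a0 b0 d0 c0 e0] := pos.
rewrite !energyE.
have [/and4P[/eqP a2 /eqP b2 /eqP c2 /eqP e2]|ne] :=
    boolP [&& a == 2, b == 2, c == 2 & e == 2].
  right; move: HL sum; rewrite a2 b2 c2 e2 /optimal => HL sum.
  by rewrite (_ : n - 9 = d) //; lia.
left; have [d1|d2] := leqP d 1.
  have {d0 d1 pos} dE : d = 1 by lia.
  rewrite {}dE in sum HM.
  (* The rival dominates every tree with [d = 1] pointwise, so its four estimates carry over to
     [H]. *)
  have le_rival (y : R) : (0 < y)%R ->
      (1 - tree_poly y (n - 8) 2 1 2 2 / tree_poly y 2 2 (n - 9) 2 2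
       <= 1 - tree_poly y a b 1 c e / tree_poly y 2 2 (n - 9) 2 2)%R.
    move=> y0; rewrite lerD2l lerN2 ler_pM2r ?invr_gt0 ?tree_poly_gt0 //.
    by apply: tree_poly_adjacent => //; lia.
  have [k [k9 k8]] : exists k, n - 9 = k.+2 /\ n - 8 = k.+3 by exists (n - 11); lia.
  rewrite k9 k8 in GM le_rival.
  apply: (energy_lt_rival eq_size GM HM) => y hy.
  - have /andP[y0 y1] := hy.
    by apply: le_trans (le_rival y y0); apply: rival_unit.
  - have y0 : (0 < y)%R by have /andP[] := hy; lra.
    by apply: le_trans (le_rival y y0); apply: rival_inner.
  - have y0 : (0 < y)%R by have /andP[] := hy; lra.
    by apply: le_trans (le_rival y y0); apply: rival_middle.
  - have y0 : (0 < y)%R by lra.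
    by apply: le_trans (le_rival y y0); apply: rival_tail.
by apply: (energy_lt eq_size GM HM) => y y0; apply: tree_poly_lt => //.
Qed.

Lemma optimal_energy_le G H : optimal G -> optimal H -> (energy R H <= energy R G)%R.
Proof.
move=> GO HO; rewrite !energyE.
apply: (energy_le _ (optimal_has_modulus GO) (optimal_has_modulus HO)) => //.
have [Gn _ _ _] := optimal_two_max GO; have [Hn _ _ _] := optimal_two_max HO.
by rewrite !size_real_spectrum Gn Hn.
Qed.

Lemma maximal_optimalP G : maximal_energy_tree R n 3 G <-> optimal G.
Proof.
split=> [[GT Gmax]|GO].
  have TO := T_a_labelled n11; have [|//] := two_max_energy TO GT.
  by rewrite real_ltNge ?num_real // Gmax //; exact: optimal_two_max.
split=> [|H HT]; first exact: optimal_two_max.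
have [/ltW//|HO] := two_max_energy GO HT; exact: optimal_energy_le.
Qed.

End Maximality.

Theorem theorem3p3 (R : realType) (n : nat) (hn : 11 <= n) :
  (forall G : sgraph,
     maximal_energy_tree R n 3 G ->
     forall H : sgraph,
       two_max_degree_tree n 3 H -> num_2branches H <= num_2branches G)
  /\
  (forall G : sgraph,
     maximal_energy_tree R n 3 G <-> isomorphic G (T_a 3 (n - 8))).
Proof.
split=> [G /(maximal_optimalP _ hn) GO H HT|G].
  have [a [b [d [c [e [[a0 b0 d0 c0 e0] sum HL]]]]]] := tree_labelled HT.
  (* Four bounds the number of 2-branches of every admissible tree and is reached by the optimal
     one. *)
  apply: (@leq_trans 4).
    exact: lab_num_2branches_le a0 b0 d0 c0 e0 sum HL.
  by apply: (lab_num_2branches_ge (b := 2) (d := n - 9) (c := 2) (e := 2)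
    _ _ _ _ _ _ GO); first [by split|lia].
rewrite (maximal_optimalP _ hn); split=> [GO|].
  exact: labelled_iso GO (T_a_labelled hn).
exact: labelled_iso_trans (T_a_labelled hn).
Qed.
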